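(* Let $1\in\mathcal{B}\subset\mathcal{A}$, $E:\mathcal{A}\to\mathcal{B}$ be an operator-valued probability space. Let $X_1,X_2,\dots\in\mathcal{A}$ be selfadjoint elements which are free with respect to $E$ and have identical $\mathcal{B}$-valued distribution. Assume that the first moments vanish, $E[X_i]=0$, and let $$\eta:\mathcal{B}\to\mathcal{B},\qquad \eta(b)=E[X_ibX_i]$$ be their covariance (which does not depend on $i$). Put $$\alpha_2:=\sup_{b\in\mathcal{B},\ \Vert b\Vert=1}\Vert E[X_ibX_i]\Vert=\Vert\eta\Vert,\qquad \alpha_4:=\sup_{b\in\mathcal{B},\ \Vert b\Vert=1}\Vert E[X_ibX_iX_ib^*X_i]\Vert .$$ Let $$S_n:=\frac{X_1+\cdots+X_n}{\sqrt n},\qquad \mathcal{B}_+:=\{b\in\mathcal{B}\mid \operatorname{Im} b\geq 0\text{ and }\operatorname{Im} b\text{ invertible}\},$$ and let $$G_n(b):=E\Bigl[\frac{1}{b-S_n}\Bigr]\qquad(b\in\mathcal{B}_+)$$ be the $\mathcal{B}$-valued Cauchy transform of $S_n$. Let $G$ denote the operator-valued Cauchy transform on $\mathcal{B}_+$ of a $\mathcal{B}$-valued semicircular element with covariance $\eta$. Then for all $b\in\mathcal{B}_+$ and all $n\in\mathbb{N}$ (with $n\ge 1$), $$\Vert G_n(b)-G(b)\Vert\leq 4\,c_n(b)\left(\Vert b\Vert+\alpha_2\cdot\Bigl\Vert\frac{1}{\operatorname{Im} b}\Bigr\Vert\right)\cdot\Bigl\Vert\frac{1}{\operatorname{Im}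 b}\Bigr\Vert^2,$$ where $$c_n(b):=\frac{1}{\sqrt n}\Bigl\Vert\frac{1}{\operatorname{Im} b}\Bigr\Vert^3\sqrt{\alpha_2}\cdot\left(2\alpha_2+\sqrt{\alpha_4+2\alpha_2^2}\right)+\frac1n\Bigl\Vert\frac{1}{\operatorname{Im} b}\Bigr\Vert^4\alpha_2^2 .$$
   Context: Operator-valued probability space: $\mathcal{A}$ is a von Neumann algebra, $\mathcal{B}\subset\mathcal{A}$ is a sub von Neumann algebra containing the identity $1$ of $\mathcal{A}$, and $E:\mathcal{A}\to\mathcal{B}$ is a conditional expectation of $\mathcal{A}$ onto $\mathcal{B}$ in the usual operator-algebraic sense (a positive linear map with $E[b]=b$ for $b\in\mathcal{B}$), so that $E[b_1ab_2]=b_1E[a]b_2$ for all $a\in\mathcal{A}$ and $b_1,b_2\in\mathcal{B}$. Freeness with respect to $E$: the $X_i$ are free with respect to $E$ (free with amalgamation over $\mathcal{B}$) if, with $\mathcal{A}_i$ the algebra generated by $\mathcal{B}$ and $X_i$, one has $E[a_1a_2\cdots a_m]=0$ whenever $m\ge1$, $a_j\in\mathcal{A}_{i_j}$, $E[a_j]=0$ for all $j$, and $i_1\ne i_2,\ i_2\ne i_3,\dots,\ i_{m-1}\neq i_m$. Identical $\mathcal{B}$-valued distribution: for all $m\geq 1$ and $b_1,\dots,b_{m-1}\in\mathcal{B}$, the moment $E[X_ib_1X_ib_2\cdots b_{m-1}X_i]$ does not depend on $i$. Notation: $\operatorname{Im} b:=(b-b^* )/(2i)$; $\frac1a$ denotes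 the inverse $a^{-1}$; $\Vert\cdot\Vert$ is the operator norm, and $\Vert\eta\Vert$ is the norm of $\eta$ as a linear map on $\mathcal{B}$. For $b\in\mathcal{B}_+$ and selfadjoint $X$, the element $b-X$ is invertible. $\mathcal{B}$-valued semicircular element with covariance $\eta$: a selfadjoint element $s$ of some operator-valued probability space over $\mathcal{B}$ (with conditional expectation also denoted $E$) whose only non-vanishing $\mathcal{B}$-valued free cumulant is the second one, given by $b\mapsto E[sbs]=\eta(b)$. Equivalently, its moments $m_k(b_1,\dots,b_{k-1}):=E[sb_1sb_2\cdots b_{k-1}s]$ (with $k$ factors $s$) satisfy $m_0=1$, $m_1=0$, and for $k\ge2$ $$m_k(b_1,\dots,b_{k-1})=\eta(b_1)\,t_2+\sum_{j=3}^{k}\eta\bigl(b_1\,m_{j-2}(b_2,\dots,b_{j-2})\,b_{j-1}\bigr)\,t_j,$$ where $t_j=b_j\,m_{k-j}(b_{j+1},\dots,b_{k-1})$ for $j<k$ and $t_k=1$. Its operator-valued Cauchy transform is $G(b)=E[(b-s)^{-1}]$ for $b\in\mathcal{B}_+$. *)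

(* Defs.v *)
From mathcomp Require Export all_boot all_order all_algebra sesquilinear.
From mathcomp Require Export complex.
From mathcomp Require Export all_classical all_reals all_analysis.
Export Order.TTheory GRing.Theory Num.Theory numFieldNormedType.Exports.

Set Implicit Arguments.
Unset Strict Implicit.
Unset Printing Implicit Defensive.

Local Open Scope classical_set_scope.
Local Open Scope complex_scope.
Local Open Scope ring_scope.

(* The inner product is linear in its first argument. *)
Record hilbertSpace (R : realType) := HilbertSpace {
  hs_space :> completeNormedModType R[i];
  hs_dot : {dot hs_space for Num.conj};
  hs_dot_norm : forall x, hs_dot x x = `|x| ^+ 2
}.

Section Operators.
Variables (R : realType) (H : hilbertSpace R).
Implicit Types (T : H -> H) (M : set (H -> H)).

(* For linear maps, bounded and continuous are the same. *)
Definition bounded_operator T := linear T /\ continuous T.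

Definition is_adjoint T T' := forall x y, hs_dot H (T x) y = hs_dot H x (T' y).

Definition commutant M : set (H -> H) :=
  [set T | bounded_operator T /\ forall U, M U -> T \o U = U \o T].

(* Being equal to its bicommutant makes M a unital subalgebra of B(H). *)
Definition is_von_neumann M :=
  commutant (commutant M) = M /\
  forall T, M T -> exists2 T', M T' & is_adjoint T T'.

Definition opnorm T : R :=
  sup [set complex.Re `|T x| | x in [set x : H | `|x| <= 1]].

Definition positive_operator T := forall x, 0 <= hs_dot H (T x) x.

End Operators.

(* A von Neumann algebra of operators on [vn_space], whose elements are named
   by an algebra isomorphic to it through [vn_act].  In a [unitAlgType],
   [a \is a GRing.unit] says that [a] has a two-sided inverse, which is then
   [a^-1], and [1 != 0], so that the zero algebra is left out (it has no
   elements of norm 1). *)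
Record vonNeumannAlgebra (R : realType) := VonNeumannAlgebra {
  vn_alg :> unitAlgType R[i];
  vn_space : hilbertSpace R;
  vn_act : vn_alg -> vn_space -> vn_space;
  star : vn_alg -> vn_alg;
  vn_act_inj : injective vn_act;
  vn_actP : forall k a b x,
    vn_act (k *: a + b) x = k *: vn_act a x + vn_act b x;
  vn_actM : forall a b x, vn_act (a * b) x = vn_act a (vn_act b x);
  vn_act1 : forall x, vn_act 1 x = x;
  vn_act_star : forall a, is_adjoint (vn_act a) (vn_act (star a));
  vn_act_von_neumann : is_von_neumann (range vn_act)
}.

Section VonNeumannAlgebra.
Variables (R : realType) (A : vonNeumannAlgebra R).
Implicit Types a : A.

Definition vnorm a : R := opnorm (vn_act a).

Definition vpositive a := positive_operator (vn_act a).

Definition selfadjoint a := star a = a.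

Definition imag a : A := (2 * 'i)^-1 *: (a - star a).

Definition upper_half : set A :=
  [set a | vpositive (imag a) /\ imag a \is a GRing.unit].

End VonNeumannAlgebra.

(* An operator-valued probability space over B.  The inclusion of B into the
   larger algebra is given as an embedding, because one and the same B has to
   be included in two different algebras. *)
Record ovProbSpace (R : realType) (B : vonNeumannAlgebra R) := OvProbSpace {
  ov_alg :> vonNeumannAlgebra R;
  incl : {lrmorphism B -> ov_alg};
  incl_inj : injective incl;
  incl_star : forall b, incl (star b) = star (incl b);
  incl_von_neumann : is_von_neumann [set vn_act (incl b) | b in [set: B]];
  cexp : {linear ov_alg -> B};
  cexp_positive : forall a, vpositive a -> vpositive (cexp a);
  cexp_incl : forall b, cexp (incl b) = b;
  cexp_bimodule : forall b1 a b2,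
    cexp (incl b1 * a * incl b2) = b1 * cexp a * b2
}.
Arguments incl {R B} o.
Arguments cexp {R B} o.

Section OvProbSpace.
Variables (R : realType) (B : vonNeumannAlgebra R) (A : ovProbSpace B).
Implicit Types (x : A) (X : nat -> A).

Definition generated_algebra x : set A :=
  smallest (fun M : set A => GRing.subalg_closed [in M])
           (range (incl A) `|` [set x]).

Definition free_family X :=
  forall (m : nat) (i : nat -> nat) (a : nat -> A), (0 < m)%N ->
    (forall j, (j < m)%N ->
       generated_algebra (X (i j)) (a j) /\ cexp A (a j) = 0) ->
    (forall j, (j.+1 < m)%N -> i j <> i j.+1) ->
    cexp A (\prod_(j < m) a j) = 0.

(* [moment x k b] is E[x b_1 x b_2 ... b_(k-1) x] with k factors x; only the
   values b 1, ..., b (k-1) of the sequence b matter. *)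
Definition moment x (k : nat) (b : nat -> B) : B :=
  if k is 0%N then 1
  else cexp A (x * \prod_(1 <= j < k) (incl A (b j) * x)).

Definition identically_distributed X :=
  forall (i j m : nat) (b : nat -> B), (1 <= m)%N ->
    moment (X i) m b = moment (X j) m b.

Definition covariance x (b : B) : B := cexp A (x * incl A b * x).

(* The moment-cumulant recursion (over the block containing the first factor)
   when the only non-vanishing free cumulant is the second one, eta. *)
Definition semicircular (eta : B -> B) (s : A) :=
  [/\ selfadjoint s,
      forall b, moment s 1 b = 0 &
      forall (k : nat) (b : nat -> B), (2 <= k)%N ->
        let t j := if j == k then 1
                   else b j * moment s (k - j) (fun l => b (j + l)%N) in
        moment s k b = eta (b 1%N) * t 2%N
          + \sum_(3 <= j < k.+1)
              eta (b 1%N * moment s (j - 2) (fun l => b l.+1) * b j.-1) * t j].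

Definition cauchy x (b : B) : B := cexp A ((incl A b - x)^-1).

Definition normalized_sum X (n : nat) : A :=
  ((Num.sqrt (n%:R : R))^-1)%:C *: \sum_(i < n) X i.

Definition alpha2 x : R :=
  sup [set vnorm (covariance x b) | b in [set b : B | vnorm b = 1]].

Definition alpha4 x : R :=
  sup [set vnorm (cexp A (x * incl A b * x * x * incl A (star b) * x))
      | b in [set b : B | vnorm b = 1]].

End OvProbSpace.

(* Main.v *)
Require Import Defs.
From HB Require Import structures.
From mathcomp Require Import ring lra zify.

(** Write [r] for the norm of [1 / Im b].  Let [Q] and [Q_i] be the resolvents at [b] of [S_n] and
    of [S_n - X_i / sqrt n].  Expanding [Q] around [Q_i] to second order and using that [X_i] is
    free from [Q_i] gives [b G_n = 1 + eta(G_n) G_n + theta] with [|theta| <= c_n(b)].  Resolvents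
    enter the freeness relations as norm limits of polynomials: if [Im a >= d > 0], then
    [1 + i c a] is a strict contraction for small [c > 0], and [a^-1] is given by a Neumann series
    in it.

    The moment recursion of the semicircular element [s] says that
    [E[s p] = sum eta(E[p1]) E[p2]] over the decompositions [p = p1 s p2] of a monomial [p].
    Applied to the powers of [1 + i c (b - s)] and summed, it becomes [b G = 1 + eta(G) G] for
    every [b] in the upper half-plane, without analytic continuation in [b].

    Thus [g = G_n(b)] solves [g^-1 = l - eta(g)] exactly at the nearby point [l = g^-1 + eta(g)],
    while [h = G(b)] solves [h^-1 = b - eta(h)].  Then [D = g - h] satisfies
    [D = g (b - l) h + g eta(D) h], and [u = - Im g], [v = - Im h] satisfy
    [u = g (Im l) g^* + g eta(u) g^*] and [v = h^* (Im b) h + h^* eta(v) h].  Comparing the three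
    equations, positivity of the matrix [[t u, D], [D^*, t v]] for some [t] implies its positivity
    for a smaller [t], down to [t = |b - l| / k] if [Im l, Im b >= k]; this bounds [D].  If [l] is
    too far from [b] for this, the claimed bound is at least [r], and [|G_n - G| <= r] because both
    transforms lie in the ball of radius [r / 2] around [- i r / 2]. *)

Set Implicit Arguments.
Unset Strict Implicit.
Unset Printing Implicit Defensive.

Local Open Scope classical_set_scope.
Local Open Scope complex_scope.
Local Open Scope ring_scope.

(** * Hilbert spaces *)

Lemma geometric_small (R : realType) (M q e : R) : 0 <= q -> q < 1 -> 0 < e ->
  exists n0, forall n, (n0 <= n)%N -> M * q ^+ n <= e.
Proof.
move=> q0 q1 e0.
have /cvgrPdist_le : (fun n => M * q ^+ n) @ \oo --> (M * 0 : R).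
  by apply: cvgMr; apply: cvg_expr; rewrite ger0_norm.
move=> /(_ e e0)[n0 _ hn0]; exists n0 => n /hn0 /=.
by rewrite mulr0 sub0r normrN => /(le_trans (ler_norm _)).
Qed.

Section Hilbert.
Variables (R : realType) (H : hilbertSpace R).
Implicit Types (x y z : H) (k : R).

(** The real inner product keeps all estimates in the ordered field [R]. The imaginary part is
    recovered as [rdot x ('i *: y)]. *)
Definition rdot x y : R := complex.Re (hs_dot H x y).
Definition hnorm x : R := complex.Re `|x|.

Lemma ReD (a b : R[i]) : complex.Re (a + b) = complex.Re a + complex.Re b.
Proof. by case: a; case: b. Qed.

Lemma ReM (k : R) (b : R[i]) : complex.Re (k%:C * b) = k * complex.Re b.
Proof. by case: b => c d /=; rewrite mul0r subr0. Qed.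

Lemma hs_dotC x y : hs_dot H x y = (hs_dot H y x)^*%C.
Proof. by rewrite hermC expr0 mul1r. Qed.

Lemma rdotC x y : rdot x y = rdot y x.
Proof. by rewrite /rdot hs_dotC; case: (hs_dot H y x). Qed.

Lemma rdotDl x y z : rdot (x + y) z = rdot x z + rdot y z.
Proof. by rewrite /rdot linearDl ReD. Qed.

Lemma rdotDr x y z : rdot z (x + y) = rdot z x + rdot z y.
Proof. by rewrite rdotC rdotDl !(rdotC z). Qed.

Lemma rdotZl k x y : rdot (k%:C *: x) y = k * rdot x y.
Proof. by rewrite /rdot linearZl_LR /= ReM. Qed.

Lemma rdotZr k x y : rdot x (k%:C *: y) = k * rdot x y.
Proof. by rewrite rdotC rdotZl rdotC. Qed.

Lemma rdotNl x y : rdot (- x) y = - rdot x y.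
Proof. by rewrite -scaleN1r (_ : -1 = (-1)%:C) ?rdotZl ?mulN1r // rmorphN1. Qed.

Lemma rdotNr x y : rdot x (- y) = - rdot x y.
Proof. by rewrite rdotC rdotNl rdotC. Qed.

Lemma rdotBl x y z : rdot (x - y) z = rdot x z - rdot y z.
Proof. by rewrite rdotDl rdotNl. Qed.

Lemma rdotBr x y z : rdot z (x - y) = rdot z x - rdot z y.
Proof. by rewrite rdotDr rdotNr. Qed.

Lemma rdot_il x y : rdot ('i *: x) y = - rdot x ('i *: y).
Proof.
by rewrite /rdot linearZl_LR linearZr_LR /=; case: (hs_dot H x y) => a b /=; ring.
Qed.

Lemma rdot_ii x y : rdot ('i *: x) ('i *: y) = rdot x y.
Proof. by rewrite rdot_il scalerA -expr2 sqr_i scaleN1r rdotNr opprK. Qed.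

Lemma hnormE x : `|x| = (hnorm x)%:C.
Proof. by rewrite RRe_real // ger0_real. Qed.

Lemma hnorm_ge0 x : 0 <= hnorm x.
Proof. by rewrite -ler0c -hnormE normr_ge0. Qed.

Lemma rdotxx x : rdot x x = hnorm x ^+ 2.
Proof. by rewrite /rdot hs_dot_norm hnormE -rmorphXn. Qed.

Lemma rdotxx_ge0 x : 0 <= rdot x x.
Proof. by rewrite rdotxx sqr_ge0. Qed.

Lemma hnorm0 : hnorm 0 = 0.
Proof. by rewrite /hnorm normr0. Qed.

Lemma hnorm_eq0 x : hnorm x = 0 -> x = 0.
Proof. by move=> h; apply/normr0_eq0; rewrite hnormE h. Qed.

Lemma hnormD x y : hnorm (x + y) <= hnorm x + hnorm y.
Proof. by rewrite -lecR rmorphD /= -!hnormE ler_normD. Qed.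

Lemma hnormN x : hnorm (- x) = hnorm x.
Proof. by rewrite /hnorm normrN. Qed.

Lemma hnormZ (c : R[i]) x : hnorm (c *: x) = complex.Re `|c| * hnorm x.
Proof.
by rewrite /hnorm normrZ hnormE mulrC ReM mulrC.
Qed.

Lemma hnormZr k x : hnorm (k%:C *: x) = `|k| * hnorm x.
Proof. by rewrite hnormZ normc_def /= expr0n addr0 sqrtr_sqr. Qed.

Lemma hnormi x : hnorm ('i *: x) = hnorm x.
Proof. by rewrite hnormZ normc_def /= expr0n add0r expr1n sqrtr1 mul1r. Qed.

(** Evaluate at the vertex [- b / a]. The Cauchy-Schwarz inequalities for the inner product, for
    positive operators and for [cexp] all come from this; [a = 0] is included because the forms may
    be degenerate. *)
Lemma discr_le (a b c : R) : 0 <= a -> 0 <= c ->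
  (forall k, 0 <= a * k ^+ 2 + 2 * b * k + c) -> b ^+ 2 <= a * c.
Proof.
move=> a0 c0 h; have [a_eq0|a_neq0] := eqVneq a 0.
  have [-> |b_neq0] := eqVneq b 0; first by rewrite expr0n mulr_ge0.
  have := h (- (c + 1) / (2 * b)).
  rewrite a_eq0 mul0r add0r.
  have -> : 2 * b * (- (c + 1) / (2 * b)) + c = -1 by field.
  by rewrite ler0N1.
have a_gt0 : 0 < a by rewrite lt_def a_neq0.
have := h (- b / a).
have -> : a * (- b / a) ^+ 2 + 2 * b * (- b / a) + c = (a * c - b ^+ 2) / a by field.
by rewrite pmulr_lge0 ?invr_gt0 // subr_ge0.
Qed.

Lemma rdot_sqr_le x y : rdot x y ^+ 2 <= rdot x x * rdot y y.
Proof.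
apply: discr_le; rewrite ?rdotxx_ge0 // => k.
have := rdotxx_ge0 (k%:C *: x + y).
rewrite rdotDl !rdotDr !rdotZl !rdotZr (rdotC y x) => h; nra.
Qed.

Lemma rdot_le x y : rdot x y <= hnorm x * hnorm y.
Proof.
have := rdot_sqr_le x y; rewrite !rdotxx -exprMn.
have h0 : 0 <= hnorm x * hnorm y by rewrite mulr_ge0 ?hnorm_ge0.
move=> h; apply: le_trans (ler_norm _) _.
by rewrite -(@ler_pXn2r _ 2) ?nnegrE // real_normK ?num_real.
Qed.

Lemma rdot_nondeg x : (forall y, rdot x y = 0) -> x = 0.
Proof.
by move=> /(_ x); rewrite rdotxx => /eqP; rewrite sqrf_eq0 => /eqP /hnorm_eq0.
Qed.

Lemma hs_dotE x y : hs_dot H x y = rdot x y +i* rdot x ('i *: y).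
Proof.
apply/eqP; rewrite eq_complex /= eqxx /= /rdot linearZr_LR /=.
by case: (hs_dot H x y) => a b /=; apply/eqP; ring.
Qed.

Definition bounded_by (M : R) (T : H -> H) := forall x, hnorm (T x) <= M * hnorm x.

Lemma bounded_operatorP (T : H -> H) :
  bounded_operator T <-> linear T /\ exists M, bounded_by M T.
Proof.
split=> -[linT h]; split=> //.
  pose f : {linear H -> H} := HB.pack T (GRing.isLinear.Build _ _ _ _ _ linT).
  have /linear_boundedP : bounded_near f (nbhs 0) by exact/linear_bounded_continuous.
  move=> /pinfty_ex_gt0 [M M0 hM]; exists (complex.Re M) => x.
  have : (`|f x| <= M * `|x|) by exact: hM.
  by rewrite -(RRe_real (gtr0_real M0)) !hnormE -rmorphM lecR.
pose f : {linear H -> H} := HB.pack T (GRing.isLinear.Build _ _ _ _ _ linT).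
apply/(linear_bounded_continuous f)/linear_boundedP; have [M hM] := h.
exists M%:C; split; first by apply/complex_realP; exists M.
move=> N MN x; rewrite !hnormE.
apply: (@le_trans _ _ (M%:C * (hnorm x)%:C)); first by rewrite -rmorphM lecR hM.
by rewrite ler_wpM2r ?ler0c ?hnorm_ge0 // ltW.
Qed.

Lemma hnorm_complete (u : nat -> H) (M q : R) : 0 <= q -> q < 1 -> 0 <= M ->
  (forall n, hnorm (u n.+1 - u n) <= M * q ^+ n) ->
  exists x, forall e, 0 < e ->
    exists n0, forall n, (n0 <= n)%N -> hnorm (x - u n) <= e.
Proof.
move=> q0 q1 M0 hu.
have q1' : 0 < 1 - q by rewrite subr_gt0.
have tele n m : hnorm (u (n + m)%N - u n) <= M / (1 - q) * (q ^+ n - q ^+ (n + m)).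
  elim: m => [|m IH]; first by rewrite addn0 !subrr mulr0 hnorm0.
  rewrite addnS -(subrK (u (n + m)%N) (u (n + m).+1)) -addrA.
  apply: le_trans (hnormD _ _) _; apply: le_trans (lerD (hu _) IH) _.
  by rewrite exprS le_eqVlt; apply/orP; left; apply/eqP; field; lra.
have tail n m : (n <= m)%N -> hnorm (u m - u n) <= M / (1 - q) * q ^+ n.
  move=> /subnKC <-; apply: le_trans (tele _ _) _.
  rewrite ler_wpM2l ?divr_ge0 // ?(ltW q1') // lerBlDr lerDl.
  by rewrite exprn_ge0.
have : cvg (u @ \oo).
  apply: cauchy_cvg; apply/cauchy_exP => e e0.
  have e0' : 0 < complex.Re e by move: e0; rewrite ltcE => /andP[].
  have [n0 hn0] := geometric_small (M / (1 - q)) q0 q1 (divr_gt0 e0' (ltr0n _ 2)).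
  exists (u n0); exists n0 => // n /= n0n.
  rewrite -ball_normE /= distrC hnormE.
  rewrite -(RRe_real (gtr0_real e0)) ltcR.
  apply: le_lt_trans (tail _ _ n0n) _; apply: le_lt_trans (hn0 _ (leqnn _)) _.
  lra.
move=> /cvg_ex[x /cvgrPdist_le hx]; exists x => e e0.
have [|n0 _ hn0] := hx e%:C; first by rewrite ltcR.
by exists n0 => n n0n; have := hn0 n n0n; rewrite /= hnormE lecR.
Qed.

End Hilbert.

(** * Von Neumann algebras *)

Local Notation "a @< x" := (vn_act a x) (at level 35, right associativity).

Section VonNeumann.
Variables (R : realType) (A : vonNeumannAlgebra R).
Implicit Types (a b c z : A) (x y : vn_space A) (k m : R).

(** Boundedness is built into the commutant, so it follows from the equality of the algebra with its
    bicommutant. *)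
Lemma vn_act_bounded_op a : bounded_operator (vn_act a).
Proof.
have : range (@vn_act R A) (vn_act a) by exists a.
by have [<- _] := vn_act_von_neumann A; case.
Qed.

Lemma vn_act_linear a : linear (vn_act a).
Proof. by case: (vn_act_bounded_op a). Qed.

Lemma actDl a b x : (a + b) @< x = a @< x + b @< x.
Proof. by have := vn_actP 1 a b x; rewrite !scale1r. Qed.

Lemma act0l x : (0 : A) @< x = 0.
Proof. by have /eqP := actDl 0 0 x; rewrite addr0 -subr_eq subrr => /eqP. Qed.

Lemma actZl (s : R[i]) a x : (s *: a) @< x = s *: (a @< x).
Proof. by have := vn_actP s a 0 x; rewrite act0l !addr0. Qed.

Lemma actNl a x : (- a) @< x = - (a @< x).
Proof. by rewrite -scaleN1r actZl scaleN1r. Qed.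

Lemma actBl a b x : (a - b) @< x = a @< x - b @< x.
Proof. by rewrite actDl actNl. Qed.

Lemma actDr a x y : a @< (x + y) = a @< x + a @< y.
Proof. by have := vn_act_linear a 1 x y; rewrite !scale1r. Qed.

Lemma act0r a : a @< 0 = 0.
Proof. by have /eqP := actDr a 0 0; rewrite addr0 -subr_eq subrr => /eqP. Qed.

Lemma actZr (s : R[i]) a x : a @< (s *: x) = s *: (a @< x).
Proof. by have := vn_act_linear a s x 0; rewrite act0r !addr0. Qed.

Lemma actNr a x : a @< (- x) = - (a @< x).
Proof. by rewrite -scaleN1r actZr scaleN1r. Qed.

Lemma actBr a x y : a @< (x - y) = a @< x - a @< y.
Proof. by rewrite actDr actNr. Qed.

Lemma act_ext a b : (forall x, a @< x = b @< x) -> a = b.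
Proof. by move=> h; apply: vn_act_inj; apply/funext. Qed.

Lemma act_ext_rdot a b : (forall x y, rdot (a @< x) y = rdot (b @< x) y) -> a = b.
Proof.
move=> h; apply: act_ext => x; apply/eqP; rewrite -subr_eq0; apply/eqP.
by apply: rdot_nondeg => y; rewrite rdotBl h subrr.
Qed.

Lemma vnorm_has_sup a :
  has_sup [set complex.Re `|a @< x| | x in [set x | `|x| <= 1]].
Proof.
split; first by exists (complex.Re `|a @< 0|), 0 => //=; rewrite normr0.
have [_ [M hM]] := (bounded_operatorP _).1 (vn_act_bounded_op a).
exists `|M| => _ [x /= x1 <-]; apply: le_trans (hM x) _.
move: x1; rewrite hnormE -[1]/(1%:C) lecR => x1.
apply: le_trans (ler_norm _) _; rewrite normrM (ger0_norm (hnorm_ge0 x)).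
by rewrite ler_piMr.
Qed.

Lemma hnorm_act a x : hnorm (a @< x) <= vnorm a * hnorm x.
Proof.
have [x0|x0] := eqVneq (hnorm x) 0.
  by rewrite (hnorm_eq0 x0) act0r !hnorm0 mulr0.
have xp : 0 < hnorm x by rewrite lt_def x0 hnorm_ge0.
rewrite -ler_pdivrMr //; apply: (ub_le_sup (vnorm_has_sup a).2).
exists ((hnorm x)^-1%:C *: x).
  rewrite /= hnormE hnormZr ger0_norm ?invr_ge0 ?hnorm_ge0 // mulVf //.
rewrite actZr -/(hnorm _) hnormZr ger0_norm ?invr_ge0 ?hnorm_ge0 //.
by rewrite mulrC.
Qed.

Lemma vnorm_le a m : 0 <= m -> (forall x, hnorm (a @< x) <= m * hnorm x) -> vnorm a <= m.
Proof.
move=> m0 h; apply: ge_sup; first by case: (vnorm_has_sup a).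
move=> _ [x /= x1 <-]; apply: le_trans (h x) _.
by move: x1; rewrite hnormE -[1]/(1%:C) lecR => x1; rewrite ler_piMr.
Qed.

Lemma vnorm_ge0 a : 0 <= vnorm a.
Proof.
apply: le_trans (hnorm_ge0 (a @< 0)) _.
apply: (ub_le_sup (vnorm_has_sup a).2).
by exists 0 => //=; rewrite normr0.
Qed.

Lemma vnormD a b : vnorm (a + b) <= vnorm a + vnorm b.
Proof.
apply: vnorm_le => [|x]; first by rewrite addr_ge0 ?vnorm_ge0.
rewrite actDl mulrDl; apply: le_trans (hnormD _ _) _.
by rewrite lerD ?hnorm_act.
Qed.

Lemma vnormM a b : vnorm (a * b) <= vnorm a * vnorm b.
Proof.
apply: vnorm_le => [|x]; first by rewrite mulr_ge0 ?vnorm_ge0.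
rewrite vn_actM -mulrA; apply: le_trans (hnorm_act _ _) _.
by rewrite ler_wpM2l ?vnorm_ge0 ?hnorm_act.
Qed.

Lemma vnorm0 : vnorm (0 : A) = 0.
Proof.
apply/eqP; rewrite eq_le vnorm_ge0 andbT; apply: vnorm_le => // x.
by rewrite act0l hnorm0 mul0r.
Qed.

Lemma vnorm_eq0 a : vnorm a = 0 -> a = 0.
Proof.
move=> h; apply: act_ext => x; rewrite act0l; apply: hnorm_eq0.
by apply/eqP; rewrite eq_le hnorm_ge0 andbT -(mul0r (hnorm x)) -h hnorm_act.
Qed.

Lemma vnormZ_le (s : R[i]) a : vnorm (s *: a) <= complex.Re `|s| * vnorm a.
Proof.
have s0 : 0 <= complex.Re `|s| by rewrite normc_def sqrtr_ge0.
apply: vnorm_le => [|x]; first by rewrite mulr_ge0 ?vnorm_ge0.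
by rewrite actZl hnormZ -mulrA ler_wpM2l // hnorm_act.
Qed.

Lemma vnormZ k a : vnorm (k%:C *: a) = `|k| * vnorm a.
Proof.
have le j b : vnorm (j%:C *: b) <= `|j| * vnorm b.
  by apply: le_trans (vnormZ_le _ _) _; rewrite normc_def /= expr0n addr0 sqrtr_sqr.
apply/eqP; rewrite eq_le le /=.
have [->|k0] := eqVneq k 0; first by rewrite normr0 mul0r vnorm_ge0.
rewrite -ler_pdivlMl ?normr_gt0 // -normfV; apply: le_trans (le _ _).
by rewrite scalerA -rmorphM mulVf // scale1r.
Qed.

Lemma vnormN a : vnorm (- a) = vnorm a.
Proof.
have -> : - a = (-1)%:C *: a by rewrite rmorphN1 scaleN1r.
by rewrite vnormZ normrN1 mul1r.
Qed.

Lemma vnormB a b : vnorm (a - b) <= vnorm a + vnorm b.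
Proof. by rewrite -(vnormN b) vnormD. Qed.

Lemma vnorm_distC a b : vnorm (a - b) = vnorm (b - a).
Proof. by rewrite -vnormN opprB. Qed.

Lemma vnormX a n : vnorm (a ^+ n) <= vnorm a ^+ n.
Proof.
elim: n => [|n IH].
  by rewrite !expr0; apply: vnorm_le => // x; rewrite vn_act1 mul1r.
rewrite !exprS; apply: le_trans (vnormM _ _) _.
by rewrite ler_wpM2l ?vnorm_ge0.
Qed.

Lemma vnorm1 : vnorm (1 : A) = 1.
Proof.
apply/eqP; rewrite eq_le (vnormX 1 0) /= -subr_ge0 leNgt subr_lt0.
apply/negP => h; suff /eqP : (1 : A) = 0 by rewrite oner_eq0.
apply: vnorm_eq0; apply/eqP; rewrite eq_le vnorm_ge0 andbT.
have := vnormM 1 1; rewrite mulr1 => h2; have := vnorm_ge0 1 => h3; nra.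
Qed.

Lemma vnorm_sum n (f : 'I_n -> A) : vnorm (\sum_(i < n) f i) <= \sum_(i < n) vnorm (f i).
Proof.
apply: (big_ind2 (fun (a : A) (k : R) => vnorm a <= k)) => [|a k b l ak bl|//].
  by rewrite vnorm0.
exact: le_trans (vnormD _ _) (lerD ak bl).
Qed.

Lemma rdot_star a x y : rdot (a @< x) y = rdot x (star a @< y).
Proof. by rewrite /rdot vn_act_star. Qed.

Lemma rdot_starl a x y : rdot (star a @< x) y = rdot x (a @< y).
Proof. by rewrite rdotC -rdot_star rdotC. Qed.

Lemma starK : involutive (@star R A).
Proof. by move=> a; apply: act_ext_rdot => x y; rewrite !(rdot_starl, rdot_star). Qed.

Lemma starD a b : star (a + b) = star a + star b.
Proof.
apply: act_ext_rdot => x y.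
by rewrite actDl rdotDl !rdot_starl actDl rdotDr.
Qed.

Lemma starZ k a : star (k%:C *: a) = k%:C *: star a.
Proof.
apply: act_ext_rdot => x y.
by rewrite !actZl rdotZl !rdot_starl !actZl rdotZr.
Qed.

Lemma starZi a : star ('i *: a) = - ('i *: star a).
Proof.
apply: act_ext_rdot => x y.
by rewrite actNl rdotNl actZl rdot_il opprK !rdot_starl actZl actZr.
Qed.

Lemma starN a : star (- a) = - star a.
Proof.
have -> : - a = (-1)%:C *: a by rewrite rmorphN1 scaleN1r.
by rewrite starZ rmorphN1 scaleN1r.
Qed.

Lemma starB a b : star (a - b) = star a - star b.
Proof. by rewrite starD starN. Qed.

Lemma starM a b : star (a * b) = star b * star a.
Proof.
apply: act_ext_rdot => x y.
by rewrite !vn_actM !rdot_starl vn_actM.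
Qed.

Lemma star1 : star (1 : A) = 1.
Proof. by apply: act_ext_rdot => x y; rewrite rdot_starl !vn_act1. Qed.

Lemma star0 : star (0 : A) = 0.
Proof. by rewrite -(scale0r 0) (_ : 0 = 0%:C) // starZ rmorph0 !scale0r. Qed.

Lemma starV a : a \is a GRing.unit -> star a^-1 = (star a)^-1.
Proof.
move=> ua; have h1 : star a * star a^-1 = 1 by rewrite -starM mulVr // star1.
have h2 : star a^-1 * star a = 1 by rewrite -starM mulrV // star1.
have us : star a \is a GRing.unit by apply/unitrP; exists (star a^-1).
by rewrite -[LHS](mulKr us) h1 mulr1.
Qed.

Lemma vnorm_star_le a : vnorm (star a) <= vnorm a.
Proof.
apply: vnorm_le; first exact: vnorm_ge0.
move=> x; have := rdotxx (star a @< x); rewrite rdot_starl => h.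
have h2 := rdot_le x (a @< star a @< x).
have h3 := hnorm_act a (star a @< x).
have h4 := hnorm_ge0 (star a @< x); have h5 := hnorm_ge0 x; have h6 := vnorm_ge0 a.
have [->|n0] := eqVneq (hnorm (star a @< x)) 0; first by rewrite mulr_ge0.
have np : 0 < hnorm (star a @< x) by rewrite lt_def n0.
rewrite -(ler_pM2r np) -expr2 -h; apply: le_trans h2 _.
by rewrite (mulrC (vnorm a)) -mulrA ler_wpM2l.
Qed.

Lemma vnorm_star a : vnorm (star a) = vnorm a.
Proof. by apply/eqP; rewrite eq_le vnorm_star_le -{1}(starK a) vnorm_star_le. Qed.

(** * Positive elements and imaginary parts *)

Lemma vpositive_star a : vpositive a -> star a = a.
Proof.
move=> ap.
have ri x : rdot (a @< x) ('i *: x) = 0.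
  by have := ap x; rewrite hs_dotE lecE /= => /andP[/eqP].
(* Polarisation: the imaginary part of the quadratic form vanishes at [x], [y] and [x + y].
   Replacing [y] by [(- 'i) *: y] turns this into symmetry of the real form. *)
have pol x y : rdot (a @< x) ('i *: y) + rdot (a @< y) ('i *: x) = 0.
  have := ri (x + y); rewrite actDr scalerDr !rdotDl !rdotDr !ri; lra.
apply: act_ext_rdot => x y; rewrite rdot_starl.
have := pol x ((- 'i) *: y); rewrite scalerA mulrN.
rewrite -expr2 sqr_i opprK scale1r scaleNr actNr actZr rdotNl rdot_il opprK.
have -> : ('i *: ('i *: x) : vn_space A) = - x by rewrite scalerA -expr2 sqr_i scaleN1r.
by rewrite rdotNr (rdotC x); lra.
Qed.

Lemma vpositive_ge0 a x : vpositive a -> 0 <= rdot (a @< x) x.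
Proof. by move=> /(_ x); rewrite lecE => /andP[]. Qed.

Lemma vpositiveI a : star a = a -> (forall x, 0 <= rdot (a @< x) x) -> vpositive a.
Proof.
move=> sa h x; rewrite hs_dotE lecE /= h andbT.
have := rdot_star a x ('i *: x); rewrite sa actZr (rdotC x) rdot_il.
by move=> e; apply/eqP; lra.
Qed.

Lemma vpositiveP a : vpositive a <-> star a = a /\ forall x, 0 <= rdot (a @< x) x.
Proof.
split=> [h|[]]; last exact: vpositiveI.
by split=> [|x]; [exact: vpositive_star|exact: vpositive_ge0].
Qed.

Lemma rdot_conj z a x : rdot ((star z * a * z) @< x) x = rdot (a @< z @< x) (z @< x).
Proof. by rewrite !vn_actM rdot_starl. Qed.

Lemma vpositive_conj z a : vpositive a -> vpositive (star z * a * z).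
Proof.
move=> /vpositiveP[sa ha]; apply: vpositiveI => [|x].
  by rewrite !starM starK sa mulrA.
by rewrite rdot_conj.
Qed.

Lemma vpositive1 : vpositive (1 : A).
Proof.
by apply: vpositiveI => [|x]; rewrite ?star1 // vn_act1 rdotxx_ge0.
Qed.

Lemma vpositive_starM z : vpositive (star z * z).
Proof. by rewrite -{1}(mulr1 (star z)); apply/vpositive_conj/vpositive1. Qed.

Lemma rdot_starM z x : rdot ((star z * z) @< x) x = rdot (z @< x) (z @< x).
Proof. by rewrite vn_actM rdot_starl. Qed.

Lemma vnorm_le_rdot a m : 0 <= m ->
  (forall x, rdot (a @< x) (a @< x) <= m ^+ 2 * rdot x x) -> vnorm a <= m.
Proof.
move=> m0 h; apply: vnorm_le => // x; have := h x; rewrite !rdotxx -exprMn.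
by rewrite ler_pXn2r ?nnegrE ?mulr_ge0 ?hnorm_ge0.
Qed.

Lemma rdot_act_le a m x : vnorm a <= m -> rdot (a @< x) (a @< x) <= m ^+ 2 * rdot x x.
Proof.
move=> am; rewrite !rdotxx -exprMn.
have h : hnorm (a @< x) <= m * hnorm x.
  by apply: le_trans (hnorm_act _ _) _; rewrite ler_wpM2r ?hnorm_ge0.
by rewrite ler_pXn2r ?nnegrE ?hnorm_ge0 // (le_trans _ h) ?hnorm_ge0.
Qed.

Lemma rdot_act_le1 a x : rdot (a @< x) x <= vnorm a * rdot x x.
Proof.
apply: le_trans (rdot_le _ _) _; rewrite rdotxx expr2 mulrA.
by rewrite ler_wpM2r ?hnorm_ge0 ?hnorm_act.
Qed.

Lemma rdot_act_ge1 a x : - (vnorm a * rdot x x) <= rdot (a @< x) x.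
Proof. by have := rdot_act_le1 (- a) x; rewrite vnormN actNl rdotNl => h; lra. Qed.

Lemma vpositive_cs a x y : vpositive a ->
  rdot (a @< x) y ^+ 2 <= rdot (a @< x) x * rdot (a @< y) y.
Proof.
move=> ap; apply: discr_le; rewrite ?vpositive_ge0 // => k.
have := vpositive_ge0 (k%:C *: x + y) ap.
rewrite actDr actZr rdotDl !rdotDr !rdotZl !rdotZr.
rewrite (rdot_star a y) (vpositive_star ap) (rdotC y) => h; nra.
Qed.

(** Apply Cauchy-Schwarz for the form of [a] to the vectors [x] and [a @< x]. *)
Lemma vpositive_vnorm_le a m : 0 <= m -> vpositive a ->
  (forall x, rdot (a @< x) x <= m * rdot x x) -> vnorm a <= m.
Proof.
move=> m0 ap h; apply: vnorm_le_rdot => // x.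
have [->|n0] := eqVneq (rdot (a @< x) (a @< x)) 0.
  by rewrite mulr_ge0 ?rdotxx_ge0 ?sqr_ge0.
have np : 0 < rdot (a @< x) (a @< x) by rewrite lt_def n0 rdotxx_ge0.
have := vpositive_cs x (a @< x) ap => h1.
have h2 := h x; have h3 := h (a @< x).
rewrite -(ler_pM2r np) -expr2; apply: le_trans h1 _.
have -> : m ^+ 2 * rdot x x * rdot (a @< x) (a @< x) =
  (m * rdot x x) * (m * rdot (a @< x) (a @< x)) by ring.
by rewrite ler_pM ?vpositive_ge0.
Qed.

Lemma imagE a : imag a = (- 2^-1)%:C *: ('i *: (a - star a)).
Proof.
rewrite /imag scalerA; congr (_ *: _); rewrite -complexiE; apply: mulr1_eq.
rewrite -[2](rmorph_nat (real_complex R)) mulrACA -rmorphM /=.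
rewrite mulrN mulfV ?pnatr_eq0 // rmorphN rmorph1.
by rewrite -expr2 sqr_i mulN1r opprK.
Qed.

(** Both sides are the imaginary part of the inner product of [a @< x] with [x], which is
    conjugate-linear in its second argument. *)
Lemma rdot_imag a x : rdot (imag a @< x) x = rdot (a @< x) ('i *: x).
Proof.
rewrite imagE.
rewrite !actZl actBl rdotZl rdot_il rdotBl rdot_starl actZr.
by rewrite (rdotC x) rdot_il; lra.
Qed.

Lemma star_imag a : star (imag a) = imag a.
Proof.
by rewrite imagE starZ starZi starB starK -scalerN opprB.
Qed.

(** * Inverses *)

(** The inverse operator is bounded by [d^-1] and commutes with the commutant, so it lies in the
    bicommutant, which is the algebra itself. *)
Lemma unit_of_bijective a (d : R) : 0 < d ->
  (forall x, d * hnorm x <= hnorm (a @< x)) -> (forall y, exists x, a @< x = y) ->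
  a \is a GRing.unit.
Proof.
move=> d0 below surj; pose J y := projT1 (cid (surj y)).
have aJ y : a @< J y = y by rewrite /J; case: cid.
have a_inj x y : a @< x = a @< y -> x = y.
  move=> /eqP; rewrite -subr_eq0 -actBr => /eqP h; apply/eqP; rewrite -subr_eq0.
  apply/eqP/hnorm_eq0; apply/eqP; rewrite eq_le hnorm_ge0 andbT.
  by rewrite -(pmulr_rle0 _ d0); apply: le_trans (below _) _; rewrite h hnorm0.
have linJ : linear J.
  by move=> s x y; apply: a_inj; rewrite aJ actDr actZr !aJ.
have Jb : bounded_operator J.
  apply/bounded_operatorP; split=> //; exists d^-1 => x.
  by rewrite ler_pdivlMl // -{2}(aJ x).
have : range (@vn_act R A) J.
  have [<- _] := vn_act_von_neumann A; split=> // U [_ comU].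
  apply/funext => x /=; apply: a_inj; rewrite aJ.
  have /(congr1 (fun f => f (J x))) /= <- := comU (vn_act a) (ex_intro2 _ _ a I erefl).
  by rewrite aJ.
move=> [j _ jJ]; apply/unitrP; exists j.
split; apply: act_ext => x; rewrite vn_actM vn_act1 jJ //.
by apply: a_inj; rewrite aJ.
Qed.

Lemma vnorm_inv_le a (d : R) : 0 < d -> a \is a GRing.unit ->
  (forall x, d * hnorm x <= hnorm (a @< x)) -> vnorm a^-1 <= d^-1.
Proof.
move=> d0 ua h; apply: vnorm_le => [|x]; first by rewrite invr_ge0 ltW.
by rewrite ler_pdivlMl // (le_trans (h _)) // -vn_actM mulrV // vn_act1.
Qed.

Lemma neumann_unit a (q : R) : q < 1 -> vnorm a <= q -> 1 - a \is a GRing.unit.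
Proof.
move=> q1 aq; have q0 : 0 <= q := le_trans (vnorm_ge0 a) aq.
have ax x : hnorm (a @< x) <= q * hnorm x.
  by apply: le_trans (hnorm_act _ _) _; rewrite ler_wpM2r ?hnorm_ge0.
apply: (@unit_of_bijective _ (1 - q)) => [|x|y].
- by rewrite subr_gt0.
- rewrite actBl vn_act1 mulrBl mul1r lerBlDr.
  rewrite -{1}(subrK (a @< x) x); apply: le_trans (hnormD _ _) _.
  by rewrite lerD2l ax.
(* Surjectivity of [1 - a] by iterating the affine contraction whose fixed point satisfies
   [x = y + a @< x]. *)
pose u := fix u n := if n is n'.+1 then y + a @< u n' else 0.
have hu n : hnorm (u n.+1 - u n) <= hnorm y * q ^+ n.
  elim: n => [|n IH]; first by rewrite /= act0r addr0 subr0 expr0 mulr1.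
  have -> : u n.+2 - u n.+1 = a @< (u n.+1 - u n) by rewrite actBr /= opprD addrACA subrr add0r.
  by apply: le_trans (ax _) _; rewrite exprS mulrCA ler_wpM2l.
have [x hx] := hnorm_complete q0 q1 (hnorm_ge0 y) hu.
exists x; apply/eqP; rewrite -subr_eq0; apply/eqP/hnorm_eq0.
apply/eqP; rewrite eq_le hnorm_ge0 andbT; apply/ler_addgt0Pr => e e0.
have [n0 hn] := hx (e / 2) (divr_gt0 e0 (ltr0n _ 2)).
have h1 := hn n0.+1 (leqnSn _); have h2 := hn n0 (leqnn _).
have -> : (1 - a) @< x - y = (x - u n0.+1) - a @< (x - u n0).
  by rewrite /= actBl vn_act1 actBr opprB opprD !addrA addrNK addrAC.
apply: le_trans (hnormD _ _) _; rewrite hnormN add0r.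
apply: le_trans (lerD h1 (le_trans (ax _) (ler_wpM2l q0 h2))) _.
nra.
Qed.

Lemma imag_ge_contraction a (d : R) : 0 < d ->
  (forall x, d * rdot x x <= rdot (imag a @< x) x) ->
  exists c q : R, [/\ 0 < c, 0 <= q < 1 & vnorm (1 + (c%:C * 'i) *: a) <= q].
Proof.
(* The squared norm of [x + i c a x] is at most [1 - 2 * c * d + c ^+ 2 * M ^+ 2] times that of [x].
   This [c] has [c * M ^+ 2 <= d], leaving [1 - c * d]; the term [d ^+ 2] in its denominator ensures
   [c * d <= 1]. *)
move=> d0 ha; pose M := vnorm a; pose c := d / (M ^+ 2 + d ^+ 2).
have M0 : 0 <= M by apply: vnorm_ge0.
have D0 : 0 < M ^+ 2 + d ^+ 2 by nra.
have c0 : 0 < c by rewrite divr_gt0.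
have cD : c * (M ^+ 2 + d ^+ 2) = d by rewrite divfK // gt_eqF.
have cM : c * M ^+ 2 <= d by rewrite -cD ler_wpM2l ?(ltW c0) // lerDl sqr_ge0.
have cd : c * d <= 1.
  rewrite -(ler_pM2r d0) -mulrA -expr2 mul1r -[X in _ <= X]cD.
  by rewrite ler_wpM2l ?(ltW c0) // lerDr sqr_ge0.
have s0 : 0 <= 1 - c * d by rewrite subr_ge0.
exists c, (Num.sqrt (1 - c * d)); split=> //.
  by rewrite sqrtr_ge0 -[X in _ < X]sqrtr1 ltr_sqrt // gtrBl mulr_gt0.
apply: vnorm_le_rdot; rewrite ?sqrtr_ge0 // => x; rewrite sqr_sqrtr //.
rewrite actDl actZl vn_act1 -scalerA.
rewrite rdotDl !rdotDr rdotZl !rdotZr (rdotC x) rdotZl.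
rewrite rdot_ii rdot_il -rdot_imag.
have h1 := ha x; have := rdot_act_le x (lexx M).
have := rdotxx_ge0 x => h2 h3.
have h4 : c * (c * rdot (a @< x) (a @< x)) <= c * (c * (M ^+ 2 * rdot x x)).
  by rewrite !ler_wpM2l ?(ltW c0).
have h5 : c * (d * rdot x x) <= c * rdot (imag a @< x) x by rewrite ler_wpM2l ?(ltW c0).
have h6 : c * (c * M ^+ 2 * rdot x x) <= c * (d * rdot x x).
  by rewrite ler_wpM2l ?(ltW c0) // ler_wpM2r.
nra.
Qed.

Lemma imag_ge_unit a (d : R) : 0 < d ->
  (forall x, d * rdot x x <= rdot (imag a @< x) x) -> a \is a GRing.unit.
Proof.
move=> d0 /(imag_ge_contraction d0)[c [q [c0 /andP[_ q1] hq]]].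
have := neumann_unit q1 hq; rewrite opprD addNKr -scaleNr.
have ci0 : - (c%:C * 'i%C) \is a @GRing.unit R[i].
  by rewrite unitfE oppr_eq0 mulf_neq0 // eq_complex /= ?oner_eq0 ?andbF // gt_eqF.
by rewrite scaler_unit.
Qed.

Lemma vnorm_imag_inv_le a (d : R) : 0 < d ->
  (forall x, d * rdot x x <= rdot (imag a @< x) x) -> vnorm a^-1 <= d^-1.
Proof.
move=> d0 ha; apply: vnorm_inv_le => //; first exact: imag_ge_unit ha.
move=> x; have [->|x0] := eqVneq (hnorm x) 0; first by rewrite mulr0 hnorm_ge0.
have xp : 0 < hnorm x by rewrite lt_def x0 hnorm_ge0.
rewrite -(ler_pM2r xp) -mulrA -expr2 -rdotxx; apply: le_trans (ha x) _.
by rewrite rdot_imag -(hnormi x) rdot_le.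
Qed.

(** Since [1 - p = - i c a], the inverse of [a] is [- i c] times the Neumann series of [p]. The
    finite sum is a polynomial in [a], and the remainder decays like [q ^+ n]. *)
Lemma inv_approx a (d : R) : 0 < d ->
  (forall x, d * rdot x x <= rdot (imag a @< x) x) ->
  exists c q : R, let p := 1 + (c%:C * 'i) *: a in
    [/\ 0 <= q < 1, vnorm p <= q &
     forall n, a^-1 = - (c%:C * 'i) *: (\sum_(k < n) p ^+ k) + p ^+ n * a^-1].
Proof.
move=> d0 ha; have [c [q [c0 q01 hq]]] := imag_ge_contraction d0 ha.
exists c, q => p; split=> // n; have ua := imag_ge_unit d0 ha.
elim: n => [|n IH]; first by rewrite big_ord0 scaler0 add0r expr0 mul1r.
rewrite big_ord_recr /= scalerDr -addrA {1}IH; congr (_ + _).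
rewrite exprSr -mulrA {3}/p mulrDl mul1r -scalerAl mulrV // mulrDr.
by rewrite -scalerAr mulr1 scaleNr addrC addrK.
Qed.

Lemma vnorm_inv_gt0 a : a \is a GRing.unit -> 0 < vnorm a^-1.
Proof.
move=> ua; rewrite lt_def vnorm_ge0 andbT; apply/negP => /eqP/vnorm_eq0/eqP.
by rewrite invr_eq0 => /eqP a0; move: ua; rewrite a0 unitr0.
Qed.

(** Cauchy-Schwarz for the form of [a] at [a^-1 @< x] and [x], where the mixed term is
    [rdot x x]. *)
Lemma vpositive_unit_ge a x : vpositive a -> a \is a GRing.unit ->
  (vnorm a^-1)^-1 * rdot x x <= rdot (a @< x) x.
Proof.
move=> ap ua; have r0 := vnorm_inv_gt0 ua; rewrite ler_pdivrMl //.
have [->|n0] := eqVneq (rdot x x) 0.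
  by rewrite mulr_ge0 ?vnorm_ge0 ?vpositive_ge0.
have np : 0 < rdot x x by rewrite lt_def n0 rdotxx_ge0.
have := vpositive_cs (a^-1 @< x) x ap; rewrite -vn_actM mulrV // vn_act1.
rewrite rdotC => h; have h2 := rdot_act_le1 a^-1 x.
rewrite -(ler_pM2r np) -expr2; apply: le_trans h _.
have h3 := vpositive_ge0 x ap.
by rewrite mulrAC ler_wpM2r // rdotC.
Qed.

Lemma vpositive_ge_unit a (d : R) : 0 < d -> star a = a ->
  (forall x, d * rdot x x <= rdot (a @< x) x) -> a \is a GRing.unit.
Proof.
move=> d0 sa ha; have : 'i%C *: a \is a GRing.unit.
  apply: (imag_ge_unit d0) => x; apply: le_trans (ha x) _.
  by rewrite rdot_imag actZl rdot_ii.
by rewrite scaler_unit // unitfE eq_complex /= oner_eq0 andbF.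
Qed.

Lemma rdot_imag_inv a x : a \is a GRing.unit ->
  rdot (imag a^-1 @< x) x = - rdot (imag a @< a^-1 @< x) (a^-1 @< x).
Proof.
move=> ua; rewrite !rdot_imag -vn_actM mulrV // vn_act1.
by rewrite rdotC rdot_il.
Qed.

(** The counterpart of [rdot_imag_inv] with the adjoint of the inverse acting on the vector. The
    comparison of [g] with [h] uses one form for each of them. *)
Lemma rdot_imag_inv_star a x : a \is a GRing.unit ->
  rdot (imag a^-1 @< x) x = - rdot (imag a @< star a^-1 @< x) (star a^-1 @< x).
Proof.
move=> ua; rewrite !rdot_imag rdot_star actZr (rdot_star a) actZr.
by rewrite -vn_actM -starM mulVr // star1 vn_act1 rdotC rdot_il.
Qed.

Lemma imagD a b : imag (a + b) = imag a + imag b.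
Proof. by rewrite /imag starD -scalerDr opprD addrACA. Qed.

Lemma imagN a : imag (- a) = - imag a.
Proof. by rewrite /imag starN -opprD scalerN. Qed.

Lemma imag_star a : imag (star a) = - imag a.
Proof. by rewrite !imagE starK -2!scalerN opprB. Qed.

Lemma vnorm_imag a : vnorm (imag a) <= vnorm a.
Proof.
rewrite imagE vnormZ.
have h : vnorm ('i%C *: (a - star a)) <= vnorm (a - star a).
  by apply: le_trans (vnormZ_le _ _) _; rewrite normc_def /= expr0n add0r expr1n sqrtr1 mul1r.
have := vnormB a (star a); rewrite vnorm_star normrN ger0_norm ?invr_ge0 //.
by move=> h2; rewrite ler_pdivrMl //; apply: (le_trans h); lra.
Qed.

Lemma vnorm_mulV_ge1 a : a \is a GRing.unit -> 1 <= vnorm a * vnorm a^-1.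
Proof. by move=> ua; rewrite -vnorm1 -(mulrV ua) vnormM. Qed.

(** * Comparison of two solutions of the fixed-point equation *)

Section Comparison.
Variable eta : A -> A.
Hypothesis eta_linear : linear eta.
Hypothesis eta_star : forall a, eta (star a) = star (eta a).
Hypothesis eta_positive : forall a, vpositive a -> vpositive (eta a).
(** An instance of 2-positivity: the matrix [[u, a], [star a, star a * u^-1 * a]] is positive, and
    its image under [eta] is tested on the vectors [(b @< x, x)]. *)
Hypothesis eta_cs : forall u a b x, vpositive u -> u \is a GRing.unit ->
  0 <= rdot (eta u @< b @< x) (b @< x) + 2 * rdot (eta a @< x) (b @< x)
       + rdot (eta (star a * u^-1 * a) @< x) x.

Lemma etaB a b : eta (a - b) = eta a - eta b.
Proof. by rewrite addrC -scaleN1r eta_linear scaleN1r addrC. Qed.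

Lemma etaZ (s : R[i]) a : eta (s *: a) = s *: eta a.
Proof.
have eta0 : eta 0 = 0 by have := etaB 0 0; rewrite !subrr.
by rewrite -[s *: a]addr0 eta_linear eta0 addr0.
Qed.

Lemma etaN a : eta (- a) = - eta a.
Proof. by rewrite -scaleN1r etaZ scaleN1r. Qed.

Lemma imag_eta a : imag (eta a) = eta (imag a).
Proof. by rewrite /imag etaZ etaB eta_star. Qed.

(* Positivity of the matrix [[u, a], [star a, v]], tested only on the vectors
   [(b x, x)] with [b] in the algebra, which is all that [eta_cs] controls. *)
Definition cone u a v := forall b x,
  0 <= rdot (u @< b @< x) (b @< x) + 2 * rdot (a @< x) (b @< x) + rdot (v @< x) x.

(** The Schur complement [t ^+ 2 *: v - star a * u^-1 * a] is positive and stays so under [eta];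
    adding [eta_cs] brings back a matrix inequality. *)
Lemma cone_eta u a v (t : R) : 0 < t -> vpositive u -> u \is a GRing.unit -> vpositive v ->
  cone (t%:C *: u) a (t%:C *: v) -> cone (t%:C *: eta u) (eta a) (t%:C *: eta v).
Proof.
move=> t0 up uu vp h b x.
have schur : vpositive ((t ^+ 2)%:C *: v - star a * u^-1 * a).
  apply: vpositiveI => [|y].
    by rewrite starB starZ (vpositive_star vp) !starM starK starV // (vpositive_star up) mulrA.
  rewrite actBl rdotBl actZl rdotZl !vn_actM rdot_starl.
  (* This multiplier minimises the quadratic form of the matrix; the minimum is the Schur complement
     divided by [t]. *)
  have := h ((- t^-1)%:C *: (u^-1 * a)) y.
  rewrite !(actZl, actZr, rdotZl, rdotZr) vn_actM -(vn_actM u) mulrV // vn_act1.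
  rewrite (rdotC (u^-1 @< _)) => h1.
  have : 0 <= t * (t * (- t^-1 * (- t^-1 * rdot (a @< y) (u^-1 @< a @< y))) +
      2 * (- t^-1 * rdot (a @< y) (u^-1 @< a @< y)) + t * rdot (v @< y) y).
    by rewrite mulr_ge0 // ltW.
  set w := rdot _ _.
  have -> : t * (t * (- t^-1 * (- t^-1 * w)) + 2 * (- t^-1 * w) + t * rdot (v @< y) y) =
    t ^+ 2 * rdot (v @< y) y - w by field; rewrite gt_eqF.
  by [].
have := vpositive_ge0 x (eta_positive schur).
rewrite etaB etaZ actBl rdotBl actZl rdotZl => h2.
(* With the factor [t] on [b], the two inequalities add up to [t] times the claim. *)
have := eta_cs a (t%:C *: b) x up uu.
rewrite !(actZl, actZr, rdotZl, rdotZr) => h3.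
rewrite -(pmulr_rge0 _ t0); nra.
Qed.

Variables (g h b l : A) (k d m : R).
Hypotheses (k_gt0 : 0 < k) (d_gt0 : 0 < d) (m_gt0 : 0 < m).
Hypotheses (g_unit : g \is a GRing.unit) (h_unit : h \is a GRing.unit).
Hypotheses (gE : g^-1 = l - eta g) (hE : h^-1 = b - eta h).
Hypothesis l_ge : forall x, k * rdot x x <= rdot (imag l @< x) x.
Hypothesis b_ge : forall x, k * rdot x x <= rdot (imag b @< x) x.
Hypothesis g_le : forall x, rdot (imag g @< x) x <= - d * rdot x x.
Hypothesis h_le : forall x, rdot (imag h @< x) x <= - d * rdot x x.
Hypotheses (g_norm : vnorm g <= m) (h_norm : vnorm h <= m).

Let u := - imag g.
Let v := - imag h.
Let D := g - h.

Let uE x : rdot (u @< x) x =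
  rdot (imag l @< star g @< x) (star g @< x) + rdot (eta u @< star g @< x) (star g @< x).
Proof.
rewrite /u actNl rdotNl -{1}[g]invrK rdot_imag_inv_star ?unitrV // opprK invrK gE.
by rewrite imagD imagN imag_eta etaN actBl rdotBl actNl rdotNl.
Qed.

Let vE x : rdot (v @< x) x =
  rdot (imag b @< h @< x) (h @< x) + rdot (eta v @< h @< x) (h @< x).
Proof.
rewrite /v actNl rdotNl -{1}[h]invrK rdot_imag_inv ?unitrV // opprK invrK hE.
by rewrite imagD imagN imag_eta etaN actBl rdotBl actNl rdotNl.
Qed.

(** The resolvent identity [g - h = g * (h^-1 - g^-1) * h] with both fixed-point equations
    inserted. *)
Let DE : D = g * (b - l) * h + g * eta D * h.
Proof.
rewrite /D etaB -mulrDl -mulrDr.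
have -> : b - l + (eta g - eta h) = h^-1 - g^-1.
  by rewrite gE hE opprB addrACA [RHS]addrACA [- l + _]addrC [RHS]addrC addrC.
by rewrite mulrBr mulrV // mulrBl mul1r -mulrA mulVr // mulr1.
Qed.

Let u_ge x : d * rdot x x <= rdot (u @< x) x.
Proof. by rewrite actNl rdotNl; have := g_le x; lra. Qed.

Let v_ge x : d * rdot x x <= rdot (v @< x) x.
Proof. by rewrite actNl rdotNl; have := h_le x; lra. Qed.

Let u_pos : vpositive u.
Proof.
apply: vpositiveI => [|x]; first by rewrite starN star_imag.
by apply: le_trans (u_ge x); rewrite mulr_ge0 ?rdotxx_ge0 // ltW.
Qed.

Let v_pos : vpositive v.
Proof.
apply: vpositiveI => [|x]; first by rewrite starN star_imag.
by apply: le_trans (v_ge x); rewrite mulr_ge0 ?rdotxx_ge0 // ltW.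
Qed.

Let u_unit : u \is a GRing.unit.
Proof. by apply: vpositive_ge_unit u_ge => //; exact: vpositive_star. Qed.

Let u_le x : rdot (u @< x) x <= m * rdot x x.
Proof.
apply: le_trans (rdot_act_le1 _ _) _; rewrite ler_wpM2r ?rdotxx_ge0 //.
by rewrite vnormN; apply: le_trans g_norm; exact: vnorm_imag.
Qed.

Let v_le x : rdot (v @< x) x <= m * rdot x x.
Proof.
apply: le_trans (rdot_act_le1 _ _) _; rewrite ler_wpM2r ?rdotxx_ge0 //.
by rewrite vnormN; apply: le_trans h_norm; exact: vnorm_imag.
Qed.

Lemma rdot_ge_sqr a x y : - (vnorm a * (rdot x x + rdot y y)) <= 2 * rdot (a @< x) y.
Proof.
have h1 := rdot_le (- (a @< x)) y; rewrite rdotNl hnormN in h1.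
have h2 := hnorm_act a x; have h3 := hnorm_ge0 y; have h4 := vnorm_ge0 a.
have h5 : hnorm (a @< x) * hnorm y <= vnorm a * hnorm x * hnorm y by rewrite ler_wpM2r.
have h6 : vnorm a * (2 * (hnorm x * hnorm y)) <= vnorm a * (hnorm x ^+ 2 + hnorm y ^+ 2).
  by rewrite ler_wpM2l //; have := sqr_ge0 (hnorm x - hnorm y); lra.
rewrite !rdotxx; lra.
Qed.

(** By [DE] the off-diagonal term splits in two. The part with [b - l] is dominated with weight [c]
    by the contributions of [imag l] and [imag b] to [u] and [v], the part with [eta D] with weight
    [t] by those of [eta u] and [eta v]. What is left is [t - c] times the [imag] contributions, so
    a fixed share [e] of the excess can be given up. *)
Let contraction : exists2 e : R, 0 < e <= 1 & forall c t : R, 0 < c -> c <= t ->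
  vnorm (b - l) <= c * k -> cone (t%:C *: u) D (t%:C *: v) ->
  let t' := c + (1 - e) * (t - c) in cone (t'%:C *: u) D (t'%:C *: v).
Proof.
pose K := vnorm g^-1 ^+ 2 + vnorm h^-1 ^+ 2.
have g1 := vnorm_inv_gt0 g_unit; have h1 := vnorm_inv_gt0 h_unit.
have K0 : 0 < K by rewrite addr_gt0 // exprn_gt0.
have N0 : 0 < m * K + k by rewrite addr_gt0 // mulr_gt0.
(* The diagonal terms are at most [m * K] times the squared norms of [w] and [z] below, while the
   [imag] contributions are at least [k] times these. The extra [k] in the denominator gives
   [e <= 1]. *)
exists (k / (m * K + k)).
  by rewrite divr_gt0 // ler_pdivrMr // mul1r lerDr mulr_ge0 // ltW.
set e := k / _ => c t c0 ct cD ht t' a x.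
have := cone_eta (lt_le_trans c0 ct) u_pos u_unit v_pos ht.
(* This multiplier and the vector [h @< x] produce the pair of vectors [star g @< a @< x] and
   [h @< x] that [DE] calls for, so the test vectors of [cone] suffice. *)
move=> /(_ (star g * a * h^-1) (h @< x)).
rewrite -(vn_actM _ h) -mulrA mulVr // mulr1 vn_actM.
set w := star g @< a @< x; set z := h @< x => hw.
have hc := rdot_ge_sqr (b - l) z w.
have hDE : rdot (D @< x) (a @< x) = rdot ((b - l) @< z) w + rdot (eta D @< z) w.
  have -> : D @< x = g @< (b - l) @< z + g @< eta D @< z.
    by rewrite {1}DE [LHS]actDl !vn_actM.
  by rewrite rdotDl !(rdot_star g).
have aw : rdot (a @< x) (a @< x) <= K * rdot w w.
  have -> : a @< x = star g^-1 @< w.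
    by rewrite -vn_actM -starM mulrV // star1 vn_act1.
  apply: le_trans (rdot_act_le _ (lexx _)) _.
  by rewrite ler_wpM2r ?rdotxx_ge0 // vnorm_star lerDl sqr_ge0.
have xz : rdot x x <= K * rdot z z.
  have {1 2}-> : x = h^-1 @< z by rewrite -vn_actM mulVr // vn_act1.
  apply: le_trans (rdot_act_le _ (lexx _)) _.
  by rewrite ler_wpM2r ?rdotxx_ge0 // lerDr sqr_ge0.
rewrite !(actZl t%:C) !rdotZl in hw; rewrite !(actZl t'%:C) !rdotZl hDE.
move: (uE (a @< x)) (vE x) (u_le (a @< x)) (v_le x) hw; rewrite -/w -/z.
have lw := l_ge w; have bz := b_ge z.
set P1 := rdot (imag l @< w) w in lw *; set P1' := rdot (imag b @< z) z in bz *.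
set P2 := rdot (eta u @< w) w; set P2' := rdot (eta v @< z) z.
set U := rdot (u @< _) _; set V := rdot (v @< _) _ => UE VE UL VL hw.
have w0 := rdotxx_ge0 w; have z0 := rdotxx_ge0 z.
have s0 : 0 <= rdot w w + rdot z z by rewrite addr_ge0.
have eN : e * (m * K + k) = k by rewrite divfK // gt_eqF.
have e0 : 0 < e by rewrite divr_gt0.
have PU : e * (U + V) <= P1 + P1'.
  apply: (@le_trans _ _ (e * (m * K * (rdot w w + rdot z z)))).
    rewrite ler_pM2l // mulrDr lerD //.
      by apply: le_trans UL _; rewrite -mulrA ler_wpM2l // ltW.
    by apply: le_trans VL _; rewrite -mulrA ler_wpM2l // ltW.
  apply: (@le_trans _ _ (k * (rdot w w + rdot z z))); last by lra.
  by rewrite mulrA ler_wpM2r // -[X in _ <= X]eN ler_pM2l // lerDl ltW.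
have ck : c * k * (rdot w w + rdot z z) <= c * (P1 + P1').
  by rewrite -mulrA ler_pM2l //; lra.
have cc : vnorm (b - l) * (rdot w w + rdot z z) <= c * k * (rdot w w + rdot z z).
  by rewrite ler_wpM2r.
have tc : (t - c) * (e * (U + V)) <= (t - c) * (P1 + P1') by rewrite ler_wpM2l ?subr_ge0.
by rewrite UE VE in tc *; rewrite /t'; lra.
Qed.

Let cone_limit (c : R) : 0 < c -> vnorm (b - l) <= c * k -> cone (c%:C *: u) D (c%:C *: v).
Proof.
move=> c0 cD; have [e /andP[e0 e1] step] := contraction.
(* At [n = 0] the diagonal already dominates [D], because [u] and [v] are at least [d]. Each
   contraction multiplies the excess over [c] by [1 - e]. *)
pose t n : R := c + (vnorm D / d) * (1 - e) ^+ n.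
have Dd : 0 <= vnorm D / d by rewrite divr_ge0 ?vnorm_ge0 // ltW.
have e1' : 0 <= 1 - e by rewrite subr_ge0.
have ct n : c <= t n by rewrite lerDl mulr_ge0 // exprn_ge0.
have tn n : cone ((t n)%:C *: u) D ((t n)%:C *: v).
  elim: n => [a x|n IH]; last first.
    have := step c (t n) c0 (ct n) cD IH; rewrite /= /t exprS.
    by congr (cone (_%:C *: _) _ (_%:C *: _)); ring.
  rewrite /t expr0 mulr1 !actZl !rdotZl.
  have := rdot_ge_sqr D x (a @< x).
  have h1 := u_ge (a @< x); have h2 := v_ge x.
  have h3 : vnorm D / d * (d * rdot (a @< x) (a @< x)) <= vnorm D / d * rdot (u @< a @< x) (a @< x).
    by rewrite ler_wpM2l.
  have h4 : vnorm D / d * (d * rdot x x) <= vnorm D / d * rdot (v @< x) x.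
    by rewrite ler_wpM2l.
  have h5 : 0 <= c * rdot (u @< a @< x) (a @< x) by rewrite mulr_ge0 ?vpositive_ge0 // ltW.
  have h6 : 0 <= c * rdot (v @< x) x by rewrite mulr_ge0 ?vpositive_ge0 // ltW.
  move: h3 h4; rewrite !mulrA !divfK ?gt_eqF //; lra.
move=> a x; rewrite !actZl !rdotZl; apply/ler_addgt0Pr => r r0.
have e2 : 1 - e < 1 by lra.
pose P := vnorm D / d * (rdot (u @< a @< x) (a @< x) + rdot (v @< x) x).
have [n hn] := geometric_small P e1' e2 r0.
have := hn n (leqnn _); have := tn n a x; rewrite !actZl !rdotZl /t /P; lra.
Qed.

Lemma vnorm_fixpoint_diff_le : vnorm (g - h) <= k^-1 * vnorm (b - l) * m.
Proof.
apply/ler_addgt0Pr => r r0.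
(* The slack [r / m] makes [c] positive even if [b = l], and adds exactly [r] to the bound. *)
pose c := k^-1 * vnorm (b - l) + r / m.
have c0 : 0 < c by rewrite ltr_wpDl ?divr_gt0 // mulr_ge0 ?vnorm_ge0 // invr_ge0 ltW.
have cD : vnorm (b - l) <= c * k.
  by rewrite mulrDl mulrC mulrA mulfV ?gt_eqF // mul1r lerDl mulr_ge0 // ?divr_ge0 ?ltW.
have -> : k^-1 * vnorm (b - l) * m + r = c * m.
  by rewrite /c mulrDl divfK // gt_eqF.
have cm : 0 < c * m by rewrite mulr_gt0.
apply: vnorm_le_rdot => [|x]; first exact: ltW.
(* For this multiple of [D], the bounds [u, v <= m] turn the cone inequality into [rdot (D @< x) (D
   @< x) <= (c * m) ^+ 2 * rdot x x]. *)
have := cone_limit c0 cD ((- (c * m)^-1)%:C *: D) x.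
rewrite !(actZl, actZr, rdotZl, rdotZr) -/D => hx.
have := u_le (D @< x); have := v_le x.
set w := rdot (D @< x) (D @< x) in hx *; set U := rdot (u @< _) _ in hx *.
set V := rdot (v @< x) x in hx * => hV hU.
have s0 : 0 < (c * m)^-1 by rewrite invr_gt0.
have hU' : c * (- (c * m)^-1 * (- (c * m)^-1 * U)) <= (c * m)^-1 * w.
  have -> : (c * m)^-1 * w = c * ((c * m)^-1 * ((c * m)^-1 * (m * w))).
    by field; rewrite !gt_eqF.
  by rewrite !mulNr mulrN opprK !ler_pM2l.
have hV' : c * V <= c * m * rdot x x by rewrite -mulrA ler_pM2l.
rewrite expr2 -mulrA -ler_pdivrMl //; lra.
Qed.

End Comparison.

End VonNeumann.

(** * Conditional expectations *)

Section CondExp.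
Variables (R : realType) (B : vonNeumannAlgebra R) (A : ovProbSpace B).
Implicit Types (a y : A) (b c : B).

Local Notation inc := (incl A).
Local Notation E := (cexp A).

Lemma inclD b c : inc (b + c) = inc b + inc c. Proof. exact: raddfD. Qed.
Lemma inclN b : inc (- b) = - inc b. Proof. exact: raddfN. Qed.
Lemma inclB b c : inc (b - c) = inc b - inc c. Proof. exact: raddfB. Qed.
Lemma inclZ (s : R[i]) b : inc (s *: b) = s *: inc b. Proof. exact: linearZ. Qed.
Lemma inclM b c : inc (b * c) = inc b * inc c. Proof. exact: rmorphM. Qed.
Lemma incl1 : inc 1 = 1. Proof. exact: rmorph1. Qed.
Lemma cexpD a y : E (a + y) = E a + E y. Proof. exact: raddfD. Qed.
Lemma cexpN a : E (- a) = - E a. Proof. exact: raddfN. Qed.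
Lemma cexpB a y : E (a - y) = E a - E y. Proof. exact: raddfB. Qed.
Lemma cexpZ (s : R[i]) a : E (s *: a) = s *: E a. Proof. exact: linearZ. Qed.

(** A unital star-homomorphism is contractive. If [vnorm b < L], then [1 - c] is invertible in [B],
    hence so is its image; the image is then bounded below, which pushes the norm of [inc b]
    strictly under [L]. *)
Lemma incl_vnorm_le b : vnorm (inc b) <= vnorm b.
Proof.
rewrite leNgt; apply/negP => lt_b.
set H := inc b in lt_b; set L := vnorm H in lt_b.
have L0 : 0 < L := le_lt_trans (vnorm_ge0 b) lt_b.
pose c := (L ^- 2)%:C *: (star b * b).
have c1 : vnorm c < 1.
  rewrite vnormZ ger0_norm ?invr_ge0 ?sqr_ge0 // mulrC ltr_pdivrMr ?exprn_gt0 // mul1r.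
  apply: le_lt_trans (vnormM _ _) _; rewrite vnorm_star -expr2.
  by rewrite ltr_pXn2r ?nnegrE ?vnorm_ge0 // ltW.
have uc : inc (1 - c) \is a GRing.unit by rewrite rmorph_unit // (neumann_unit c1).
have M0 := vnorm_inv_gt0 uc; set M := vnorm _ in M0.
have key x : hnorm (H @< x) ^+ 2 <= L ^+ 2 * (1 - M ^- 2) * hnorm x ^+ 2.
  have h1 : hnorm x <= M * hnorm (inc (1 - c) @< x).
    by rewrite -{1}(vn_act1 x) -(mulVr uc) vn_actM hnorm_act.
  have cE : inc (1 - c) @< x = x - (L ^- 2)%:C *: (star H @< H @< x).
    by rewrite inclB incl1 actBl vn_act1 inclZ actZl inclM incl_star vn_actM.
  have h2 : hnorm (inc (1 - c) @< x) ^+ 2 <= hnorm x ^+ 2 - L ^- 2 * hnorm (H @< x) ^+ 2.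
    rewrite -rdotxx cE rdotBl !rdotBr !rdotZl !rdotZr (rdotC x) rdot_starl !rdotxx.
    have h3 : hnorm (star H @< H @< x) ^+ 2 <= L ^+ 2 * hnorm (H @< x) ^+ 2.
      rewrite -exprMn ler_pXn2r ?nnegrE ?hnorm_ge0 //; last first.
        by rewrite mulr_ge0 ?hnorm_ge0 // ltW.
      by apply: le_trans (hnorm_act _ _) _; rewrite vnorm_star.
    have h4 : L ^- 2 * (L ^- 2 * hnorm (star H @< H @< x) ^+ 2) <=
       L ^- 2 * hnorm (H @< x) ^+ 2.
      rewrite ler_pM2l ?invr_gt0 ?exprn_gt0 // ler_pdivrMl ?exprn_gt0 //.
    lra.
  have h5 : hnorm x ^+ 2 <= M ^+ 2 * (hnorm x ^+ 2 - L ^- 2 * hnorm (H @< x) ^+ 2).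
    apply: (@le_trans _ _ (M ^+ 2 * hnorm (inc (1 - c) @< x) ^+ 2)).
      rewrite -exprMn ler_pXn2r ?nnegrE ?hnorm_ge0 //.
      by rewrite mulr_ge0 ?hnorm_ge0 // ltW.
    by rewrite ler_pM2l // exprn_gt0.
  rewrite -mulrA -ler_pdivrMl ?exprn_gt0 // mulrBl mul1r lerBrDr -lerBrDl.
  by rewrite ler_pdivrMl ?exprn_gt0.
(* The factor in [key] is a square only if [1 - M ^- 2] is nonnegative; otherwise [key] forces
   [inc b] to vanish. *)
have [s1|s1] := leP 0 (1 - M ^- 2).
  have : L <= L * Num.sqrt (1 - M ^- 2).
    apply: vnorm_le_rdot => [|x]; first by rewrite mulr_ge0 ?sqrtr_ge0 // ltW.
    by rewrite !rdotxx exprMn sqr_sqrtr.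
  rewrite -{1}(mulr1 L) ler_pM2l // -{1}sqrtr1 ler_sqrt ?ltr01 //.
  by have : 0 < M ^- 2 by [rewrite invr_gt0 exprn_gt0]; lra.
suff : L <= 0 by rewrite leNgt L0.
apply: vnorm_le_rdot => // x; rewrite expr0n mul0r rdotxx; apply: le_trans (key x) _.
by rewrite mulr_le0_ge0 ?sqr_ge0 // mulr_ge0_le0 ?sqr_ge0 // ltW.
Qed.

(** Positivity is expressed through norms, which [inc] does not increase: with [M = vnorm c], a
    selfadjoint [c] is positive when [M - c] has norm at most [M]. *)
Lemma incl_ge b (m : R) : star b = b ->
  (forall x, m * rdot x x <= rdot (b @< x) x) ->
  forall x, m * rdot x x <= rdot (inc b @< x) x.
Proof.
move=> sb hb x; pose c := b - m%:C *: 1; pose M := vnorm c.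
have cp : vpositive c.
  apply: vpositiveI => [|y]; first by rewrite starB starZ star1 sb.
  by rewrite actBl actZl vn_act1 rdotBl rdotZl subr_ge0.
have hM : vnorm (M%:C *: 1 - c) <= M.
  apply: vpositive_vnorm_le => [||y]; first exact: vnorm_ge0.
    apply: vpositiveI => [|y].
      by rewrite starB starZ star1 (vpositive_star cp).
    by rewrite actBl actZl vn_act1 rdotBl rdotZl subr_ge0 rdot_act_le1.
  by rewrite actBl actZl vn_act1 rdotBl rdotZl gerBl vpositive_ge0.
have := rdot_act_le1 (inc (M%:C *: 1 - c)) x.
have h1 := le_trans (incl_vnorm_le (M%:C *: 1 - c)) hM.
have h2 : vnorm (inc (M%:C *: 1 - c)) * rdot x x <= M * rdot x x.
  by rewrite ler_wpM2r ?rdotxx_ge0.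
move=> /le_trans /(_ h2).
rewrite !inclB !inclZ incl1 !actBl !actZl !vn_act1 !rdotBl !rdotZl; lra.
Qed.

Lemma cexp1 : E 1 = 1.
Proof. by rewrite -incl1 cexp_incl. Qed.

Lemma cexp_mull b a : E (inc b * a) = b * E a.
Proof. by have := cexp_bimodule b a 1; rewrite incl1 !mulr1. Qed.

Lemma cexp_mulr b a : E (a * inc b) = E a * b.
Proof. by have := cexp_bimodule 1 a b; rewrite incl1 !mul1r. Qed.

Lemma cexp_selfadjoint a : star a = a -> star (E a) = E a.
Proof.
(* Adding its norm makes a selfadjoint element positive, and positive elements have selfadjoint
   images. *)
move=> sa; have : vpositive ((vnorm a)%:C *: 1 + a).
  apply: vpositiveI => [|x]; first by rewrite starD starZ star1 sa.
  by rewrite actDl actZl vn_act1 rdotDl rdotZl; have := rdot_act_ge1 a x; lra.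
move=> /cexp_positive; rewrite cexpD cexpZ cexp1 => /vpositive_star.
by rewrite starD starZ star1 => /addrI.
Qed.

Lemma cexp_star a : E (star a) = star (E a).
Proof.
have h1 : star (E (a + star a)) = E (a + star a).
  by apply: cexp_selfadjoint; rewrite starD starK addrC.
have h2 : star (E ('i%C *: (a - star a))) = E ('i%C *: (a - star a)).
  by apply: cexp_selfadjoint; rewrite starZi starB starK -scalerN opprB.
have i_unit : 'i%C \is a @GRing.unit R[i].
  by rewrite unitfE eq_complex /= oner_eq0 andbF.
move: h1 h2; rewrite cexpZ starZi -scalerN => h1 /(scalerI i_unit).
rewrite !cexpB starB opprB => h2; move: h1; rewrite !cexpD starD => h1.
have : star (E a) + star (E a) = E (star a) + E (star a).
  have := congr2 (fun u v => u - v) h1 h2; rewrite !opprB addrACA subrr addr0.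
  by rewrite [E a + _]addrC addrACA subrr addr0.
rewrite -!mulr2n -(scaler_nat 2 (star _)) -(scaler_nat 2 (E (star a))).
by move/scalerI => ->; rewrite // unitfE pnatr_eq0.
Qed.

Lemma cexp_imag a : imag (E a) = E (imag a).
Proof. by rewrite !imagE !cexpZ cexpB cexp_star. Qed.

Lemma cexp_ge a (m : R) : star a = a ->
  (forall x, m * rdot x x <= rdot (a @< x) x) ->
  forall x, m * rdot x x <= rdot (E a @< x) x.
Proof.
move=> sa ha x; have : vpositive (a - m%:C *: 1).
  apply: vpositiveI => [|y]; first by rewrite starB starZ star1 sa.
  by rewrite actBl actZl vn_act1 rdotBl rdotZl subr_ge0.
move=> /cexp_positive /(@vpositive_ge0 _ _ _ x).
by rewrite cexpB cexpZ cexp1 actBl actZl vn_act1 rdotBl rdotZl subr_ge0.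
Qed.

Lemma vnorm_cexp_starM_le y : vnorm (E (star y * y)) <= vnorm y ^+ 2.
Proof.
apply: vpositive_vnorm_le => [||x]; first exact: sqr_ge0.
  exact/cexp_positive/vpositive_starM.
have := @cexp_ge (- (star y * y)) (- vnorm y ^+ 2) _ _ x.
rewrite cexpN actNl rdotNl mulNr lerN2; apply=> [|z].
  by rewrite starN starM starK.
by rewrite mulNr actNl rdotNl lerN2 rdot_starM rdot_act_le.
Qed.

(** Cauchy-Schwarz for the [B]-valued inner product [E (star x * y)]. With
    [p = x * inc (k%:C *: b) + y], the positive element [E (star p * p)] is quadratic in [k] on each
    vector, and its discriminant gives [key]. *)
Lemma cexp_cs (x y : A) (m n : R) : 0 <= m -> 0 <= n ->
  vnorm (E (star x * x)) <= m ^+ 2 -> vnorm (E (star y * y)) <= n ^+ 2 ->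
  vnorm (E (star x * y)) <= m * n.
Proof.
move=> m0 n0 hx hy; apply: vnorm_le_rdot => [|z]; first by rewrite mulr_ge0.
set b := E (star x * y); set w := rdot (b @< z) (b @< z).
have key : w ^+ 2 <= (m ^+ 2 * w) * rdot (E (star y * y) @< z) z.
  apply: discr_le => [||k].
  - by rewrite mulr_ge0 ?sqr_ge0 ?rdotxx_ge0.
  - by apply/vpositive_ge0/cexp_positive/vpositive_starM.
  have := vpositive_ge0 z (cexp_positive (vpositive_starM (x * inc (k%:C *: b) + y))).
  have -> : star (x * inc (k%:C *: b) + y) * (x * inc (k%:C *: b) + y) =
     inc (k%:C *: star b) * (star x * x) * inc (k%:C *: b) +
     inc (k%:C *: star b) * (star x * y) + star y * x * inc (k%:C *: b) + star y * y.
    by rewrite starD starM -incl_star starZ mulrDl !mulrDr !mulrA !addrA.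
  rewrite !cexpD cexp_bimodule cexp_mull cexp_mulr !actDl !rdotDl.
  have -> : E (star y * x) = star b by rewrite -cexp_star starM starK.
  rewrite !vn_actM !actZl !actZr !rdotZl !rdot_starl -/b -/w.
  have := le_trans (rdot_act_le1 (E (star x * x)) (b @< z)) (ler_wpM2r (rdotxx_ge0 _) hx).
  rewrite -/w => h1 h2.
  have h3 : k ^+ 2 * rdot (E (star x * x) @< b @< z) (b @< z) <= k ^+ 2 * (m ^+ 2 * w).
    by rewrite ler_wpM2l ?sqr_ge0.
  lra.
have hyz := le_trans (rdot_act_le1 (E (star y * y)) z) (ler_wpM2r (rdotxx_ge0 _) hy).
have [w0|w0] := eqVneq w 0.
  by rewrite -/w w0 mulr_ge0 ?sqr_ge0 ?rdotxx_ge0.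
have wp : 0 < w by rewrite lt_def w0 rdotxx_ge0.
rewrite -(ler_pM2r wp) -expr2; apply: le_trans key _.
by have := ler_wpM2l (mulr_ge0 (sqr_ge0 m) (ltW wp)) hyz; lra.
Qed.

Lemma vnorm_cexp_le a : vnorm (E a) <= vnorm a.
Proof.
have := @cexp_cs 1 a 1 (vnorm a) ler01 (vnorm_ge0 a) _ (vnorm_cexp_starM_le a).
by rewrite star1 !mul1r cexp1 vnorm1 expr1n; apply.
Qed.

(** * Positivity properties of the covariance *)

Section Covariance.
Variable X : A.
Hypothesis sX : selfadjoint X.
Local Notation eta := (covariance X).

Lemma covariance_linear : linear eta.
Proof.
move=> k a b; by rewrite /covariance inclD inclZ mulrDr mulrDl cexpD -scalerAr -scalerAl cexpZ.
Qed.

Lemma covariance_star b : eta (star b) = star (eta b).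
Proof. by rewrite /covariance -cexp_star !starM sX incl_star mulrA. Qed.

Lemma incl_positive b : vpositive b -> vpositive (inc b).
Proof.
move=> /vpositiveP[sb hb]; apply: vpositiveI => [|x]; first by rewrite -incl_star sb.
by have := @incl_ge b 0 sb _ x; rewrite mul0r; apply => y; rewrite mul0r.
Qed.

Lemma covariance_positive b : vpositive b -> vpositive (eta b).
Proof.
move=> bp; apply: cexp_positive.
by rewrite -{1}sX; apply/vpositive_conj/incl_positive.
Qed.

(** Positivity of [E (star z * inc u * z)] for [z = X * inc b + inc (u^-1 * a) * X]. It supplies the
    2-positivity assumed in the comparison. *)
Lemma covariance_cs (u a b : B) x : vpositive u -> u \is a GRing.unit ->
  0 <= rdot (eta u @< b @< x) (b @< x) + 2 * rdot (eta a @< x) (b @< x)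
       + rdot (eta (star a * u^-1 * a) @< x) x.
Proof.
move=> up uu.
pose z := X * inc b + inc (u^-1 * a) * X.
have := vpositive_ge0 x (cexp_positive (vpositive_conj z (incl_positive up))).
have -> : star z * inc u * z = inc (star b) * (X * inc u * X) * inc b
  + inc (star b) * (X * inc a * X) + X * inc (star a) * X * inc b
  + X * inc (star a * u^-1 * a) * X.
  rewrite /z starD !starM sX -!incl_star starM starV // (vpositive_star up).
  rewrite !mulrDl !mulrDr !mulrA -!addrA; congr (_ + _).
  rewrite !addrA; congr (_ + _ + _); first last.
  - by rewrite !inclM !mulrA -(mulrA _ (inc u^-1) (inc u)) -inclM mulVr // incl1 mulr1.
  - by rewrite !inclM !mulrA -(mulrA _ (inc u^-1) (inc u)) -inclM mulVr // incl1 mulr1.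
  by rewrite !inclM !mulrA -(mulrA _ (inc u) (inc u^-1)) -inclM mulrV // incl1 mulr1.
rewrite !cexpD cexp_bimodule cexp_mull cexp_mulr.
rewrite -[E (X * inc (star a) * X)]/(eta (star a)) covariance_star.
rewrite !actDl !rdotDl !vn_actM !rdot_starl (rdotC (b @< x) (eta a @< x)).
rewrite /covariance; lra.
Qed.

End Covariance.

(** * Resolvents and Cauchy transforms on the upper half-plane *)

Section Resolvent.
Variables (S : A) (b : B).
Hypothesis sS : selfadjoint S.
Hypothesis b_upper : upper_half b.
Local Notation T := (inc b - S).
Local Notation r := (vnorm (imag b)^-1).

Lemma imag_norm_gt0 : 0 < r.
Proof. by case: b_upper => _; exact: vnorm_inv_gt0. Qed.

Lemma upper_half_ge x : r^-1 * rdot x x <= rdot (imag b @< x) x.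
Proof. by case: b_upper => bp bu; exact: vpositive_unit_ge. Qed.

Lemma imag_resolvent_den : imag T = inc (imag b).
Proof.
by rewrite imagD imagN {2}/imag sS subrr scaler0 subr0 !imagE !inclZ inclB incl_star.
Qed.

Lemma resolvent_den_ge x : r^-1 * rdot x x <= rdot (imag T @< x) x.
Proof.
rewrite imag_resolvent_den; apply: incl_ge x; first exact: star_imag.
exact: upper_half_ge.
Qed.

Lemma resolvent_unit : T \is a GRing.unit.
Proof. by apply: imag_ge_unit resolvent_den_ge; rewrite invr_gt0 imag_norm_gt0. Qed.

Lemma vnorm_resolvent_le : vnorm T^-1 <= r.
Proof.
rewrite -[leRHS]invrK; apply: vnorm_imag_inv_le resolvent_den_ge.
by rewrite invr_gt0 imag_norm_gt0.
Qed.

Lemma vnorm_cauchy_le : vnorm (cauchy S b) <= r.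
Proof. exact: le_trans (vnorm_cexp_le _) vnorm_resolvent_le. Qed.

Lemma imag_resolvent_le x :
  r^-1 * rdot (T^-1 @< x) (T^-1 @< x) <= - rdot (imag T^-1 @< x) x.
Proof. by rewrite rdot_imag_inv ?resolvent_unit // opprK resolvent_den_ge. Qed.

Lemma imag_cauchy_le : exists2 d : R, 0 < d &
  forall x, rdot (imag (cauchy S b) @< x) x <= - d * rdot x x.
Proof.
have r0 := imag_norm_gt0; have uT := resolvent_unit.
(* [- imag T^-1] dominates [r^-1] times [star T^-1 * T^-1], and [T^-1] is bounded below through the
   norm of [T]; the summand 1 avoids a division by zero. *)
pose d := r^-1 / (1 + vnorm T ^+ 2).
have n0 : 0 < 1 + vnorm T ^+ 2 by rewrite ltr_pwDl // sqr_ge0.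
exists d => [|x]; first by rewrite divr_gt0 // invr_gt0.
rewrite cexp_imag -[leLHS]opprK mulNr lerN2 -rdotNl -actNl -cexpN.
apply: cexp_ge x => [|x]; first by rewrite starN star_imag.
rewrite actNl rdotNl; apply: le_trans (imag_resolvent_le x).
rewrite /d -mulrA ler_pM2l ?invr_gt0 // ler_pdivrMl //.
have := rdot_act_le (T^-1 @< x) (lexx (vnorm T)).
rewrite -vn_actM mulrV // vn_act1 mulrDl mul1r => h.
by have := rdotxx_ge0 (T^-1 @< x); lra.
Qed.

Lemma cauchy_unit : cauchy S b \is a GRing.unit.
Proof.
have [d d0 hd] := imag_cauchy_le; rewrite -unitrN; apply: (imag_ge_unit d0) => x.
by rewrite imagN actNl rdotNl; have := hd x; lra.
Qed.

(** Expanding the square, [imag_resolvent_le] says exactly that [T^-1 + i r / 2] has norm at most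
    [r / 2]; then [E] is contractive. *)
Lemma cauchy_disk : vnorm (cauchy S b + ((r / 2)%:C * 'i%C) *: 1) <= r / 2.
Proof.
have -> : cauchy S b + ((r / 2)%:C * 'i%C) *: 1 = E (T^-1 + ((r / 2)%:C * 'i%C) *: 1).
  by rewrite cexpD cexpZ cexp1.
have r0 := imag_norm_gt0.
apply: le_trans (vnorm_cexp_le _) _; apply: vnorm_le_rdot => [|x].
  by rewrite divr_ge0 // ltW.
rewrite actDl actZl vn_act1 -scalerA rdotDl !rdotDr !rdotZl !rdotZr rdot_ii.
rewrite (rdotC ('i%C *: x)) -rdot_imag.
have h : r * (r^-1 * rdot (T^-1 @< x) (T^-1 @< x)) <= r * (- rdot (imag T^-1 @< x) x).
  by rewrite ler_pM2l // imag_resolvent_le.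
rewrite mulVKf ?gt_eqF // in h; lra.
Qed.

End Resolvent.

End CondExp.

(** * Freeness *)

Section Freeness.
Variables (R : realType) (B : vonNeumannAlgebra R) (A : ovProbSpace B).
Local Notation inc := (incl A).
Local Notation E := (cexp A).

Section GeneratedAlgebra.
Variable X : A.
Local Notation gen := (generated_algebra X).

Lemma gen_incl b : gen (inc b).
Proof. by move=> M [_ hM]; apply: hM; left; exists b. Qed.

Lemma gen_self : gen X.
Proof. by move=> M [_ hM]; apply: hM; right. Qed.

Lemma gen_linear (s : R[i]) (a c : A) : gen a -> gen c -> gen (s *: a + c).
Proof.
move=> ha hc M [cM hM]; have [_ lM _] := cM.
have /set_mem := lM s a c (mem_set (ha M (conj cM hM))) (mem_set (hc M (conj cM hM))).
exact.
Qed.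

Lemma genM (a c : A) : gen a -> gen c -> gen (a * c).
Proof.
move=> ha hc M [cM hM]; have [_ _ mM] := cM.
have /set_mem := mM a c (mem_set (ha M (conj cM hM))) (mem_set (hc M (conj cM hM))).
exact.
Qed.

Lemma genB (a c : A) : gen a -> gen c -> gen (a - c).
Proof. by move=> ha hc; rewrite addrC -scaleN1r; exact: gen_linear. Qed.

Lemma gen1 : gen 1.
Proof. by rewrite -(incl1 A); exact: gen_incl. Qed.

Definition centre (a : A) := a - inc (E a).

Lemma gen_centre a : gen a -> gen (centre a).
Proof. by move=> ha; apply: genB => //; exact: gen_incl. Qed.

Lemma cexp_centre a : E (centre a) = 0.
Proof. by rewrite cexpB cexp_incl subrr. Qed.

Lemma centreK a : a = centre a + inc (E a).
Proof. by rewrite subrK. Qed.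

End GeneratedAlgebra.

Variable X : nat -> A.
Hypothesis X_free : free_family X.
Local Notation gen i := (generated_algebra (X i)).

(** * Alternating words and reduced elements *)

Definition alternating (p q : nat * A) := p.1 != q.1.

Definition word (w : seq (nat * A)) :=
  sorted alternating w /\ forall p, p \in w -> gen p.1 p.2 /\ E p.2 = 0.

Definition word_prod (w : seq (nat * A)) : A := \prod_(p <- w) p.2.

Lemma word_prod_cons p w : word_prod (p :: w) = p.2 * word_prod w.
Proof. by rewrite /word_prod big_cons. Qed.

Lemma word_prod_cat w w' : word_prod (w ++ w') = word_prod w * word_prod w'.
Proof. by rewrite /word_prod big_cat. Qed.

Lemma word_prod1 p : word_prod [:: p] = p.2.
Proof. by rewrite /word_prod big_seq1. Qed.

Lemma cexp_word w : w != [::] -> word w -> E (word_prod w) = 0.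
Proof.
move=> w0 [sw hw]; pose d := (0%N, 0 : A).
rewrite /word_prod (big_nth d) big_mkord.
apply: (@X_free _ (fun j => (nth d w j).1) (fun j => (nth d w j).2)) => [|j jw|j jw].
- by rewrite lt0n size_eq0.
- exact/hw/mem_nth.
- by apply/eqP; move/(sortedP d) : sw; apply.
Qed.

Lemma word_cat p w q w' : word (p :: w) -> word (q :: w') ->
  (last p w).1 != q.1 -> word (p :: w ++ q :: w').
Proof.
move=> [sw hw] [sw' hw'] pq; split.
  by move: sw sw'; rewrite /= cat_path /= /alternating pq => -> ->.
by move=> z; rewrite -cat_cons mem_cat => /orP[/hw|/hw'].
Qed.

Lemma word_single i a : gen i a -> E a = 0 -> word [:: (i, a)].
Proof. by move=> ha ea; split=> // p; rewrite inE => /eqP ->. Qed.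

Lemma word_tail p w : word (p :: w) -> word w.
Proof.
move=> [/path_sorted sw hw]; split=> // q qw; apply: hw.
by rewrite inE qw orbT.
Qed.

Lemma word_rehead j a c w : word ((j, a) :: w) -> gen j c -> E c = 0 -> word ((j, c) :: w).
Proof.
move=> hw gc ec; have [sw lw] := hw; split; first by case: w sw {hw lw}.
move=> p; rewrite inE => /orP[/eqP -> //|pw]; apply: lw.
by rewrite inE pw orbT.
Qed.

Definition off i (w : seq (nat * A)) := forall p, p \in w -> p.1 != i.

(* Sums of words suffice for a span: a scalar is absorbed in a letter. *)
Inductive reduced (i : nat) : A -> Prop :=
| reduced0 : reduced i 0
| reducedS w y of w != [::] & word w & off i w & reduced i y : reduced i (word_prod w + y).

Lemma reduced_word i w : w != [::] -> word w -> off i w -> reduced i (word_prod w).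
Proof.
by move=> *; rewrite -[word_prod w]addr0; apply: reducedS => //; exact: reduced0.
Qed.

Lemma reducedD i y z : reduced i y -> reduced i z -> reduced i (y + z).
Proof.
move=> hy hz; elim: hy => [|w y' w0 hw ow _ IH]; first by rewrite add0r.
by rewrite -addrA; exact: reducedS.
Qed.

Lemma cexp_reduced i y : reduced i y -> E y = 0.
Proof.
elim=> [|w y' w0 hw _ _ IH]; first by rewrite raddf0.
by rewrite cexpD IH addr0 cexp_word.
Qed.

Lemma off_cons i p w : off i (p :: w) <-> p.1 != i /\ off i w.
Proof.
split=> [ow|[pi ow] q]; last by rewrite inE => /orP[/eqP ->|/ow].
by split=> [|q qw]; apply: ow; rewrite inE ?eqxx ?qw ?orbT.
Qed.

(** The decomposition of the algebra generated by [B] and the variables other than [X i] into [B]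
    and sums of alternating words, taken as the definition; closure under products is then
    proved. *)
Definition alg_off i (y : A) := exists b z, reduced i z /\ y = inc b + z.

Lemma alg_offD i y z : alg_off i y -> alg_off i z -> alg_off i (y + z).
Proof.
move=> [b [y' [hy ->]]] [c [z' [hz ->]]]; exists (b + c), (y' + z'); split.
  exact: reducedD.
by rewrite inclD addrACA.
Qed.

Lemma alg_off_incl i b : alg_off i (inc b).
Proof. by exists b, 0; split; [exact: reduced0|rewrite addr0]. Qed.

Lemma alg_off_reduced i y : reduced i y -> alg_off i y.
Proof. by move=> hy; exists 0, y; rewrite raddf0 add0r. Qed.

Lemma alg_off0 i : alg_off i 0.
Proof. exact/alg_off_reduced/reduced0. Qed.

Lemma alg_off1 i : alg_off i 1.
Proof. by have := alg_off_incl i 1; rewrite incl1. Qed.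

Lemma alg_off_word i w : word w -> off i w -> alg_off i (word_prod w).
Proof.
have [-> _ _|w0 hw ow] := eqVneq w [::].
  by rewrite /word_prod big_nil; exact: alg_off1.
exact/alg_off_reduced/reduced_word.
Qed.

Lemma alg_off_incl_mul_word i b w : word w -> off i w -> alg_off i (inc b * word_prod w).
Proof.
case: w => [_ _|[j a] w hw /off_cons[ji ow]].
  by rewrite /word_prod big_nil mulr1; exact: alg_off_incl.
have -> : inc b * word_prod ((j, a) :: w) = word_prod ((j, inc b * a) :: w).
  by rewrite !word_prod_cons mulrA.
have [_ /(_ _ (mem_head _ _))[ga ea]] := hw.
apply: alg_off_word; last exact/off_cons.
apply: word_rehead hw _ _; first by apply: genM => //; exact: gen_incl.
by rewrite cexp_mull ea mulr0.
Qed.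

(** A new leading letter either meets a different label and is centred, or merges with a first
    letter of the same label and the product is centred again. The [B]-part split off is absorbed by
    the next letter. *)
Lemma alg_off_gen_mul_word i j c w : j != i -> gen j c -> word w -> off i w ->
  alg_off i (c * word_prod w).
Proof.
move=> ji gc hw ow.
have cons_centre w' a : gen j a -> word ((j, centre a) :: w') -> off i w' ->
    alg_off i (a * word_prod w').
  move=> ga hw' ow'; rewrite {1}(centreK a) mulrDl; apply: alg_offD.
    rewrite -(word_prod_cons (j, centre a)).
    by apply: alg_off_word => //; exact/off_cons.
  by apply: alg_off_incl_mul_word => //; exact: word_tail hw'.
case: w hw ow => [|[k a] w] hw ow.
  by apply: cons_centre => //; apply: word_single; [exact: gen_centre|exact: cexp_centre].
have [_ /(_ _ (mem_head _ _))[/= ga ea]] := hw.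
have [kj|kj] := eqVneq k j.
  rewrite word_prod_cons mulrA; have [_ ow'] := (off_cons _ _ _).1 ow.
  rewrite kj in hw ga; apply: cons_centre => //; first exact: genM.
  by apply: word_rehead hw _ _; [apply: gen_centre; exact: genM|exact: cexp_centre].
apply: cons_centre => //; have [sw lw] := hw; split.
  by move: sw => /= ->; rewrite andbT /alternating /= eq_sym.
move=> p; rewrite inE => /orP[/eqP ->|/lw //] /=.
by split; [exact: gen_centre|exact: cexp_centre].
Qed.

Lemma alg_off_incl_mul i b y : alg_off i y -> alg_off i (inc b * y).
Proof.
move=> [c [z [hz ->]]]; rewrite mulrDr -inclM; apply: alg_offD.
  exact: alg_off_incl.
elim: hz => [|w y' w0 hw ow _ IH]; first by rewrite mulr0; exact: alg_off0.
by rewrite mulrDr; apply: alg_offD => //; exact: alg_off_incl_mul_word.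
Qed.

Lemma alg_off_gen_mul i j c y : j != i -> gen j c -> alg_off i y -> alg_off i (c * y).
Proof.
move=> ji gc [b [z [hz ->]]]; rewrite mulrDr; apply: alg_offD.
  have := @alg_off_gen_mul_word i j (c * inc b) [::] ji.
  rewrite /word_prod big_nil mulr1; apply=> //.
  by apply: genM => //; exact: gen_incl.
elim: hz => [|w y' w0 hw ow _ IH]; first by rewrite mulr0; exact: alg_off0.
by rewrite mulrDr; apply: alg_offD => //; exact: (alg_off_gen_mul_word ji).
Qed.

Lemma alg_offM i y z : alg_off i y -> alg_off i z -> alg_off i (y * z).
Proof.
move=> [b [y' [hy ->]]] hz; rewrite mulrDl; apply: alg_offD.
  exact: alg_off_incl_mul.
elim: hy => [|w u w0 hw ow _ IH]; first by rewrite mul0r; exact: alg_off0.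
rewrite mulrDl; apply: alg_offD => // {w0 IH u}.
elim: w hw ow => [|p w IH] hw ow; first by rewrite /word_prod big_nil mul1r.
have [pi ow'] := (off_cons _ _ _).1 ow.
have [_ /(_ _ (mem_head _ _))[gp _]] := hw.
rewrite word_prod_cons -mulrA; apply: (alg_off_gen_mul pi gp).
by apply: IH => //; exact: word_tail hw.
Qed.

Lemma alg_off_centred i y : alg_off i y -> E y = 0 -> reduced i y.
Proof.
move=> [b [z [hz ->]]]; rewrite cexpD cexp_incl (cexp_reduced hz) addr0 => ->.
by rewrite raddf0 add0r.
Qed.

(** * Norm closure of the algebra avoiding one variable *)

Definition closure_off i (y : A) :=
  forall e : R, 0 < e -> exists2 p, alg_off i p & vnorm (y - p) <= e.

Lemma closure_off_alg i y : alg_off i y -> closure_off i y.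
Proof. by move=> hy e e0; exists y; rewrite // subrr vnorm0 ltW. Qed.

Lemma closure_off_incl i b : closure_off i (inc b).
Proof. exact/closure_off_alg/alg_off_incl. Qed.

Lemma closure_off_gen i j : j != i -> closure_off i (X j).
Proof.
move=> ji; apply: closure_off_alg; rewrite -(mulr1 (X j)).
by apply: (alg_off_gen_mul ji (@gen_self _)); exact: alg_off1.
Qed.

Lemma closure_offD i y z : closure_off i y -> closure_off i z -> closure_off i (y + z).
Proof.
move=> hy hz e e0; have e2 : 0 < e / 2 by rewrite divr_gt0.
have [p hp yp] := hy _ e2; have [q hq zq] := hz _ e2.
exists (p + q); first exact: alg_offD.
by rewrite opprD addrACA; apply: le_trans (vnormD _ _) _; lra.
Qed.

Lemma closure_offM i y z : closure_off i y -> closure_off i z -> closure_off i (y * z).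
Proof.
move=> hy hz e e0; pose m := vnorm z + 1.
have m0 : 0 < m by rewrite ltr_wpDl ?vnorm_ge0.
have [p hp yp] := hy (e / 2 / m) (divr_gt0 (divr_gt0 e0 (ltr0n _ 2)) m0).
pose n := vnorm p + 1.
have n0 : 0 < n by rewrite ltr_wpDl ?vnorm_ge0.
have [q hq zq] := hz (e / 2 / n) (divr_gt0 (divr_gt0 e0 (ltr0n _ 2)) n0).
exists (p * q); first exact: alg_offM.
have -> : y * z - p * q = (y - p) * z + p * (z - q).
  by rewrite mulrBl mulrBr addrA subrK.
apply: le_trans (vnormD _ _) _; rewrite [e]splitr; apply: lerD.
  apply: le_trans (vnormM _ _) _.
  apply: (@le_trans _ _ (e / 2 / m * m)); last by rewrite divfK // gt_eqF.
  by rewrite ler_pM ?vnorm_ge0 // lerDl.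
apply: le_trans (vnormM _ _) _.
apply: (@le_trans _ _ (n * (e / 2 / n))); last by rewrite mulrC divfK // gt_eqF.
by rewrite ler_pM ?vnorm_ge0 // lerDl.
Qed.

Lemma closure_offZ i (s : R[i]) y : closure_off i y -> closure_off i (s *: y).
Proof.
move=> hy; have -> : s *: y = inc (s *: 1) * y by rewrite inclZ incl1 -scalerAl mul1r.
by apply: closure_offM => //; exact: closure_off_incl.
Qed.

Lemma closure_offB i y z : closure_off i y -> closure_off i z -> closure_off i (y - z).
Proof. by move=> hy hz; rewrite -scaleN1r; apply/closure_offD/closure_offZ. Qed.

Lemma closure_off_sum i n (P : pred 'I_n) (f : 'I_n -> A) :
  (forall k, P k -> closure_off i (f k)) -> closure_off i (\sum_(k < n | P k) f k).
Proof.
move=> hf; elim/big_ind: _ => //; last exact: closure_offD.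
exact/closure_off_alg/alg_off0.
Qed.

Lemma closure_off_exp i y n : closure_off i y -> closure_off i (y ^+ n).
Proof.
move=> hy; elim: n => [|n IH]; last by rewrite exprS; exact: closure_offM.
by rewrite expr0; exact/closure_off_alg/alg_off1.
Qed.

Lemma closure_off_closed i y :
  (forall e : R, 0 < e -> exists2 p, closure_off i p & vnorm (y - p) <= e) -> closure_off i y.
Proof.
move=> hy e e0; have e2 : 0 < e / 2 by rewrite divr_gt0.
have [p hp yp] := hy _ e2; have [q hq pq] := hp _ e2; exists q => //.
by rewrite -(subrK p y) -addrA; apply: le_trans (vnormD _ _) _; lra.
Qed.

Lemma closure_off_inv i y (d : R) : 0 < d ->
  (forall x, d * rdot x x <= rdot (imag y @< x) x) -> closure_off i y -> closure_off i y^-1.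
Proof.
move=> d0 hy cy; have [c [q /= [/andP[q0 q1] hq hinv]]] := inv_approx d0 hy.
apply: closure_off_closed => e e0.
have [n hn] := geometric_small (vnorm y^-1) q0 q1 e0.
exists (- (c%:C * 'i%C) *: (\sum_(k < n) (1 + (c%:C * 'i%C) *: y) ^+ k)).
  apply: closure_offZ; apply: closure_off_sum => k _; apply: closure_off_exp.
  apply: closure_offD; last exact: closure_offZ.
  exact/closure_off_alg/alg_off1.
rewrite {1}(hinv n) addrC addKr.
apply: le_trans (vnormM _ _) _; apply: le_trans (hn n (leqnn _)).
rewrite mulrC ler_wpM2l ?vnorm_ge0 //; apply: le_trans (vnormX _ _) _.
by rewrite lerXn2r ?nnegrE ?vnorm_ge0.
Qed.

Lemma closure_off_centred i y : closure_off i y -> E y = 0 ->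
  forall e : R, 0 < e -> exists2 p, reduced i p & vnorm (y - p) <= e.
Proof.
(* Centring the approximant moves it by at most the same error once more, hence the half. *)
move=> hy ey e e0; have [p hp yp] := hy (e / 2) (divr_gt0 e0 (ltr0n _ 2)).
exists (centre p).
  apply: alg_off_centred (cexp_centre _); apply: alg_offD => //.
  by rewrite -inclN; exact: alg_off_incl.
have -> : y - centre p = (y - p) - inc (E (y - p)).
  by rewrite cexpB ey sub0r inclN opprK /centre opprB addrA addrAC.
apply: le_trans (vnormB _ _) _.
have := le_trans (incl_vnorm_le A _) (vnorm_cexp_le (y - p)); lra.
Qed.

(** * Vanishing of sandwiched expectations *)

Lemma cexp_sandwich_closure i (u v y : A) : closure_off i y -> E y = 0 ->
  (forall p, reduced i p -> E (u * p * v) = 0) -> E (u * y * v) = 0.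
Proof.
move=> hy ey huv; apply: vnorm_eq0; apply/eqP; rewrite eq_le vnorm_ge0 andbT.
apply/ler_addgt0Pr => e e0; rewrite add0r.
pose m := vnorm u * vnorm v + 1.
have m0 : 0 < m by rewrite ltr_wpDl ?mulr_ge0 ?vnorm_ge0.
have [p hp yp] := closure_off_centred hy ey (divr_gt0 e0 m0).
rewrite -(subr0 (E _)) -(huv p hp) -cexpB -mulrBl -mulrBr.
apply: le_trans (vnorm_cexp_le _) _; apply: le_trans (vnormM _ _) _.
apply: (@le_trans _ _ (vnorm u * (e / m) * vnorm v)).
  rewrite ler_wpM2r ?vnorm_ge0 //; apply: le_trans (vnormM _ _) _.
  by rewrite ler_wpM2l ?vnorm_ge0.
rewrite mulrAC mulrC -[leRHS](divfK (x := m)) ?gt_eqF // ler_wpM2l ?lerDl //.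
by apply: divr_ge0; exact: ltW.
Qed.

(** Split [a] and [c] into centred parts and [B]-parts: each of the four terms contains an
    alternating word, as both end labels of the middle word differ from [i]. *)
Lemma cexp_sandwich_word i p w (a c : A) : word (p :: w) -> p.1 != i ->
  (last p w).1 != i -> gen i a -> gen i c -> E (a * word_prod (p :: w) * c) = 0.
Proof.
move=> hw pi wi ga gc; set u := word_prod _.
have hc : word [:: (i, centre c)].
  by apply: word_single; [exact: gen_centre|exact: cexp_centre].
have hwc := word_cat hw hc wi.
have ha q w' : word (q :: w') -> q.1 != i -> word ((i, centre a) :: q :: w').
  move=> hw' qi; apply: (@word_cat (i, centre a) [::]) => //; last by rewrite eq_sym.
  by apply: word_single; [exact: gen_centre|exact: cexp_centre].
have Eu : E u = 0 by rewrite cexp_word.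
have Euc : E (u * centre c) = 0.
  by rewrite -[centre c](word_prod1 (i, _)) -word_prod_cat cexp_word.
have Eau : E (centre a * u) = 0.
  by rewrite -(word_prod_cons (i, centre a)) cexp_word //; exact: ha.
have Eauc : E (centre a * (u * centre c)) = 0.
  rewrite -[centre c](word_prod1 (i, _)) -word_prod_cat.
  by rewrite -(word_prod_cons (i, centre a)) cexp_word //; exact: ha.
rewrite (centreK c) mulrDr cexpD cexp_mulr {2}(centreK a) mulrDl cexpD.
rewrite Eau cexp_mull Eu mulr0 addr0 mul0r addr0.
rewrite {1}(centreK a) mulrDl mulrDl cexpD -!mulrA Eauc.
by rewrite cexp_mull Euc mulr0 addr0.
Qed.

Lemma cexp_sandwich_reduced i (a c y : A) : gen i a -> gen i c -> reduced i y ->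
  E (a * y * c) = 0.
Proof.
move=> ga gc; elim=> [|w y' w0 hw ow _ IH]; first by rewrite mulr0 mul0r raddf0.
rewrite mulrDr mulrDl cexpD IH addr0.
case: w w0 hw ow => // p w _ hw ow; apply: (cexp_sandwich_word hw _ _ ga gc).
  by apply: ow; rewrite mem_head.
by apply: ow; rewrite mem_last.
Qed.

Lemma cexp_sandwich i (a c y : A) : gen i a -> gen i c -> closure_off i y -> E y = 0 ->
  E (a * y * c) = 0.
Proof.
move=> ga gc hy ey; apply: cexp_sandwich_closure hy ey _ => p hp.
exact: (cexp_sandwich_reduced ga gc hp).
Qed.

(** The centred letter [c] of label [i] links a word of [y] and a word of [z] into one alternating
    word. *)
Lemma cexp_sandwich2_reduced i (a c d y z : A) : gen i a -> gen i c -> E c = 0 ->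
  gen i d -> reduced i y -> reduced i z -> E (a * y * c * z * d) = 0.
Proof.
move=> ga gc ec gd hy; elim=> [|w z' w0 hw ow _ IH].
  by rewrite mulr0 mul0r raddf0.
rewrite mulrDr mulrDl cexpD IH addr0 => {IH z'}.
elim: hy => [|v y' v0 hv ov _ IH]; first by rewrite mulr0 !mul0r raddf0.
rewrite mulrDr !mulrDl cexpD IH addr0 => {IH y'}.
case: w w0 hw ow => // q w _ hw ow; case: v v0 hv ov => // p v _ hv ov.
have -> : a * word_prod (p :: v) * c * word_prod (q :: w) * d =
    a * word_prod (p :: v ++ (i, c) :: q :: w) * d.
  by rewrite -cat_cons word_prod_cat (word_prod_cons (i, c)) !mulrA.
apply: (cexp_sandwich_word _ _ _ ga gd).
- apply: word_cat => //; last by apply: ov; rewrite mem_last.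
  apply: (@word_cat (i, c) [::]) => //; first exact: word_single.
  by rewrite eq_sym; apply: ow; rewrite mem_head.
- by apply: ov; rewrite mem_head.
- by rewrite last_cat /=; apply: ow; rewrite mem_last.
Qed.

Lemma cexp_sandwich2 i (a c d y z : A) : gen i a -> gen i c -> E c = 0 ->
  gen i d -> closure_off i y -> E y = 0 -> closure_off i z -> E z = 0 ->
  E (a * y * c * z * d) = 0.
Proof.
move=> ga gc ec gd hy ey hz ez; apply: cexp_sandwich_closure hz ez _ => q hq.
rewrite -!mulrA !(mulrA c) mulrA; apply: cexp_sandwich_closure hy ey _ => p hp.
by rewrite !mulrA; exact: cexp_sandwich2_reduced hq.
Qed.

Lemma closure_off_decomp i y : closure_off i y ->
  exists u b, [/\ closure_off i u, E u = 0 & y = u + inc b].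
Proof.
move=> hy; exists (centre y), (E y); split; last exact: centreK.
  by apply: closure_offB => //; exact: closure_off_incl.
exact: cexp_centre.
Qed.

(** * Mixed moments of one variable and elements free from it *)

Section Moments.
Variable i : nat.
Let g1 : gen i 1. Proof. exact: gen1. Qed.
Let gb b : gen i (inc b). Proof. exact: gen_incl. Qed.

Lemma cexp_gen_closure a y : gen i a -> closure_off i y -> E (a * y) = E a * E y.
Proof.
move=> ga /closure_off_decomp[u [b [hu eu ->]]].
rewrite mulrDr !cexpD cexp_mulr eu add0r cexp_incl -[a * u]mulr1.
by rewrite (cexp_sandwich ga g1 hu eu) add0r.
Qed.

(** This identifies the second-order term of the resolvent expansion; the centred part of [y]
    contributes nothing. *)
Lemma cexp_free_xyxz x y z : gen i x -> E x = 0 -> closure_off i y -> closure_off i z ->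
  E (x * y * x * z) = E (x * inc (E y) * x) * E z.
Proof.
move=> gx ex /closure_off_decomp[u [b [hu eu ->]]] hz.
have -> : x * (u + inc b) * x * z = x * u * x * z + x * inc b * x * z.
  by rewrite mulrDr !mulrDl.
have gxb : gen i (x * inc b * x) by exact: (genM (genM gx (gb _)) gx).
rewrite [E (u + _)]cexpD eu add0r cexp_incl cexpD (cexp_gen_closure gxb hz).
have -> : E (x * u * x * z) = 0; last by rewrite add0r.
have [v [g [hv ev ->]]] := closure_off_decomp hz.
rewrite mulrDr cexpD cexp_mulr (cexp_sandwich gx gx hu eu) mul0r addr0.
by rewrite -[x * u * x * v]mulr1 (cexp_sandwich2 gx gx ex g1 hu eu hv ev).
Qed.

Lemma cexp_free_yaz a y z : gen i a -> closure_off i y -> closure_off i z ->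
  E (y * a * z) = E (y * inc (E a) * z).
Proof.
move=> ga hy hz; have gc := gen_centre ga.
suff : E (y * centre a * z) = 0.
  by rewrite /centre mulrBr mulrBl cexpB => /eqP; rewrite subr_eq0 => /eqP.
have ec := cexp_centre a; move: (centre a) gc ec => c gc ec.
have [u [b [hu eu ->]]] := closure_off_decomp hy.
have [v [g [hv ev ->]]] := closure_off_decomp hz.
have -> : (u + inc b) * c * (v + inc g) =
    1 * u * c * v * 1 + inc b * (c * v * 1) + (1 * u * c * inc g + inc b * c * inc g).
  by rewrite mulrDr !mulrDl !mulr1 !mul1r mulrA.
rewrite !cexpD (cexp_sandwich2 g1 gc ec g1 hu eu hv ev) cexp_mull.
rewrite (cexp_sandwich gc g1 hv ev) mulr0 !cexp_mulr (cexp_sandwich g1 gc hu eu).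
by rewrite cexp_mull ec mulr0 !mul0r !addr0.
Qed.

Lemma cexp_centred_quad a c d u v : gen i a -> gen i c -> gen i d ->
  closure_off i u -> E u = 0 -> closure_off i v -> E v = 0 ->
  E (a * u * c * v * d) = E (a * inc (E (u * inc (E c) * v)) * d).
Proof.
move=> ga gc gd hu eu hv ev.
rewrite [in LHS](centreK c); have := cexp_centre c; have := gen_centre gc.
move: (centre c) => c0 gc0 ec0; rewrite mulrDr !mulrDl cexpD.
rewrite (cexp_sandwich2 ga gc0 ec0 gd hu eu hv ev) add0r.
have hc : closure_off i (u * inc (E c) * v).
  by apply: closure_offM hv; apply: closure_offM hu _; exact: closure_off_incl.
have -> : a * u * inc (E c) * v * d = a * (u * inc (E c) * v) * d by rewrite !mulrA.
have [w [g [hw ew ->]]] := closure_off_decomp hc.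
by rewrite mulrDr mulrDl !cexpD (cexp_sandwich ga gd hw ew) ew !add0r cexp_incl.
Qed.

(** Split [y] and [z] into centred parts and [B]-parts. The two [B]-parts give a moment of [x] and
    [a] alone; the two centred parts see only [E a] and give the covariance of [y] and [z]; the
    mixed terms vanish. *)
Lemma cexp_free_xyazx x a y z : gen i x -> gen i a -> closure_off i y -> closure_off i z ->
  E (x * y * a * z * x) = E (x * inc (E y) * a * inc (E z) * x)
    + E (x * inc (E (y * inc (E a) * z) - E y * E a * E z) * x).
Proof.
move=> gx ga hy hz.
have [u [b [hu eu ->]]] := closure_off_decomp hy.
have [v [g [hv ev ->]]] := closure_off_decomp hz.
have -> : E (u + inc b) = b by rewrite cexpD eu add0r cexp_incl.
have -> : E (v + inc g) = g by rewrite cexpD ev add0r cexp_incl.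
have -> : E ((u + inc b) * inc (E a) * (v + inc g)) - b * E a * g = E (u * inc (E a) * v).
  rewrite mulrDr cexpD cexp_mulr [(u + _) * _]mulrDl [E (u * _ + _)]cexpD cexp_mulr eu mul0r.
  rewrite add0r cexp_mull cexp_incl addrK [(_ + _) * v]mulrDl cexpD -(mulrA (inc b)).
  by rewrite cexp_mull cexp_mull ev !mulr0 addr0.
have -> : x * (u + inc b) * a * (v + inc g) * x =
    x * u * a * v * x + x * inc b * a * v * x
    + (x * u * (a * inc g * x) + x * inc b * a * inc g * x).
  by rewrite [x * (u + inc b)]mulrDr (mulrDl _ _ a) mulrDr !mulrDl !mulrA.
rewrite !cexpD.
rewrite (cexp_centred_quad gx ga gx hu eu hv ev).
have gba : gen i (x * inc b * a) by exact: (genM (genM gx (gb _)) ga).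
rewrite (cexp_sandwich gba gx hv ev) addr0.
have gga : gen i (a * inc g * x) by exact: (genM (genM ga (gb _)) gx).
by rewrite (cexp_sandwich gx gga hu eu) add0r addrC.
Qed.

End Moments.

End Freeness.

(** * The approximate equation for the sum *)

Section Sups.
Variables (R : realType) (B : vonNeumannAlgebra R) (A : ovProbSpace B).
Local Notation inc := (incl A).
Local Notation E := (cexp A).

Lemma unit_vnorm_decomp (b : B) : vnorm b != 0 ->
  b = (vnorm b)%:C *: ((vnorm b)^-1%:C *: b) /\ vnorm ((vnorm b)^-1%:C *: b) = 1.
Proof.
move=> b0; split; first by rewrite scalerA -rmorphM mulfV // scale1r.
by rewrite vnormZ ger0_norm ?invr_ge0 ?vnorm_ge0 // mulVf.
Qed.

Lemma vnorm_covariance_le (x : A) (b : B) :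
  vnorm (covariance x b) <= alpha2 x * vnorm b.
Proof.
have ub : has_ubound [set vnorm (covariance x b) | b in [set b : B | vnorm b = 1]].
  exists (vnorm x * vnorm x) => _ [c /= c1 <-]; apply: le_trans (vnorm_cexp_le _) _.
  apply: le_trans (vnormM _ _) _; rewrite ler_wpM2r ?vnorm_ge0 //.
  apply: le_trans (vnormM _ _) _; rewrite ler_piMr ?vnorm_ge0 // -c1.
  exact: incl_vnorm_le.
have [b0|b0] := eqVneq (vnorm b) 0.
  rewrite b0 mulr0 (vnorm_eq0 b0) /covariance (raddf0 inc) mulr0 mul0r raddf0.
  by rewrite vnorm0.
have [e c1] := unit_vnorm_decomp b0; set c := (vnorm b)^-1%:C *: b in e c1.
have -> : covariance x b = (vnorm b)%:C *: covariance x c.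
  by rewrite {1}e /covariance inclZ -scalerAr -scalerAl cexpZ.
rewrite vnormZ ger0_norm ?vnorm_ge0 // mulrC ler_wpM2r ?vnorm_ge0 //.
by apply: (ub_le_sup ub); exists c.
Qed.

Lemma vnorm_fourth_le (x : A) (b : B) :
  vnorm (E (x * inc b * x * x * inc (star b) * x)) <= alpha4 x * vnorm b ^+ 2.
Proof.
have ub : has_ubound [set vnorm (E (x * inc b * x * x * inc (star b) * x))
    | b in [set b : B | vnorm b = 1]].
  exists (vnorm x * vnorm x * vnorm x * vnorm x) => _ [c /= c1 <-].
  apply: le_trans (vnorm_cexp_le _) _.
  have sc : vnorm (inc (star c)) <= 1.
    by apply: le_trans (incl_vnorm_le _ _) _; rewrite vnorm_star c1.
  have ic : vnorm (inc c) <= 1 by apply: le_trans (incl_vnorm_le _ _) _; rewrite c1.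
  apply: le_trans (vnormM _ _) _; rewrite ler_wpM2r ?vnorm_ge0 //.
  apply: le_trans (vnormM _ _) _; apply: le_trans (ler_piMr (vnorm_ge0 _) sc) _.
  apply: le_trans (vnormM _ _) _; rewrite ler_wpM2r ?vnorm_ge0 //.
  apply: le_trans (vnormM _ _) _; rewrite ler_wpM2r ?vnorm_ge0 //.
  apply: le_trans (vnormM _ _) _; exact: (ler_piMr (vnorm_ge0 _) ic).
have [b0|b0] := eqVneq (vnorm b) 0.
  rewrite b0 expr0n mulr0 (vnorm_eq0 b0) (raddf0 inc) mulr0 !mul0r raddf0.
  by rewrite vnorm0.
have [e c1] := unit_vnorm_decomp b0; set c := (vnorm b)^-1%:C *: b in e c1.
have -> : E (x * inc b * x * x * inc (star b) * x) =
    (vnorm b ^+ 2)%:C *: E (x * inc c * x * x * inc (star c) * x).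
  rewrite {1 2}e starZ !inclZ -!(scalerAr, scalerAl) !cexpZ scalerA.
  by rewrite -rmorphM -expr2.
rewrite vnormZ ger0_norm ?sqr_ge0 // mulrC ler_wpM2r ?sqr_ge0 //.
by apply: (ub_le_sup ub); exists c.
Qed.

Lemma alpha2_ge0 (x : A) : 0 <= alpha2 x.
Proof.
by have := vnorm_covariance_le x 1; rewrite vnorm1 mulr1; apply: le_trans (vnorm_ge0 _).
Qed.

Lemma alpha4_ge0 (x : A) : 0 <= alpha4 x.
Proof.
have := vnorm_fourth_le x 1; rewrite vnorm1 expr1n mulr1.
by apply: le_trans (vnorm_ge0 _).
Qed.

(** As [star c * c] is at most [vnorm c ^+ 2], a left factor can be traded for its norm while [w]
    keeps its expectation. *)
Lemma vnorm_cexp_mul_le (c w : A) :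
  vnorm (E (star (c * w) * (c * w))) <= vnorm c ^+ 2 * vnorm (E (star w * w)).
Proof.
apply: vpositive_vnorm_le => [||x].
- by rewrite mulr_ge0 ?sqr_ge0 ?vnorm_ge0.
- exact/cexp_positive/vpositive_starM.
have : vpositive (((vnorm c ^+ 2)%:C *: (star w * w)) - star (c * w) * (c * w)).
  apply: vpositiveI => [|y].
    by rewrite starB starZ !starM !starK.
  by rewrite actBl rdotBl actZl rdotZl !rdot_starM vn_actM subr_ge0 rdot_act_le.
move=> /cexp_positive /(@vpositive_ge0 _ _ _ x).
rewrite cexpB cexpZ actBl rdotBl actZl rdotZl subr_ge0 => h; apply: le_trans h _.
by rewrite -mulrA ler_wpM2l ?sqr_ge0 // rdot_act_le1.
Qed.

End Sups.

Section MasterEquation.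
Variables (R : realType) (B : vonNeumannAlgebra R) (A : ovProbSpace B) (X : nat -> A).
Hypothesis X_selfadjoint : forall i, selfadjoint (X i).
Hypothesis X_free : free_family X.
Hypothesis X_ident : identically_distributed X.
Hypothesis X_centred : forall i, cexp A (X i) = 0.
Variables (b : B) (n : nat).
Hypothesis b_upper : upper_half b.
Hypothesis n_gt0 : (1 <= n)%N.

Local Notation inc := (incl A).
Local Notation E := (cexp A).
Local Notation eta := (covariance (X 0%N)).
Local Notation a2 := (alpha2 (X 0%N)).
Local Notation a4 := (alpha4 (X 0%N)).
Local Notation r := (vnorm (imag b)^-1).
Local Notation Sn := (normalized_sum X n).
Let e : R := (Num.sqrt (n%:R : R))^-1.
Let Rn := (inc b - Sn)^-1.
Let g := cauchy Sn b.

Lemma covariance_ident i c : covariance (X i) c = eta c.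
Proof.
have := X_ident i 0%N (fun _ => c) (isT : (1 <= 2)%N).
by rewrite /moment !big_nat1 !mulrA.
Qed.

Lemma fourth_ident i c :
  E (X i * inc c * X i * X i * inc (star c) * X i) =
  E (X 0%N * inc c * X 0%N * X 0%N * inc (star c) * X 0%N).
Proof.
(* The coefficients [c], 1, [star c] at positions 1 to 3 turn [moment] with four factors into this
   expression. *)
pose s j : B := if j == 1%N then c else if j == 2%N then 1 else star c.
have := X_ident i 0%N s (isT : (1 <= 4)%N).
rewrite /moment !(big_ltn (m := 1)) // !(big_ltn (m := 2)) // !(big_ltn (m := 3)) //.
by rewrite !big_geq // /s /= !incl1 !mul1r !mulr1 !mulrA.
Qed.

Lemma normalized_sum_selfadjoint : selfadjoint Sn.
Proof.
rewrite /selfadjoint /normalized_sum starZ; congr (_ *: _).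
apply: (big_ind (fun y : A => star y = y)) => [|y z hy hz|i _].
- exact: star0.
- by rewrite starD hy hz.
- exact: X_selfadjoint.
Qed.

(** * The contribution of a single summand *)

Section Term.
Variable i : 'I_n.
Let x := X i.
Let S := Sn - e%:C *: x.
Let Q := (inc b - S)^-1.
Let h := E Q.

Let SE : S = e%:C *: (\sum_(j < n | j != i) X j).
Proof. by rewrite /S /normalized_sum (bigD1 i) //= scalerDr addrC addKr. Qed.

Let S_sa : selfadjoint S.
Proof.
by rewrite /selfadjoint starB starZ normalized_sum_selfadjoint (X_selfadjoint i).
Qed.

Let S_off : closure_off X i S.
Proof.
rewrite SE; apply: closure_offZ; apply: closure_off_sum => j ji.
exact: closure_off_gen.
Qed.

Let Q_off : closure_off X i Q.
Proof.
apply: closure_off_inv (resolvent_den_ge S_sa b_upper) _.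
  by rewrite invr_gt0 (imag_norm_gt0 b_upper).
by apply: closure_offB => //; exact: closure_off_incl.
Qed.

Let Qs_off : closure_off X i (star Q).
Proof.
have uT := resolvent_unit S_sa b_upper.
(* The adjoint denominator has negative imaginary part, so its negative is inverted. *)
rewrite /Q starV // -[star _]opprK invrN -scaleN1r; apply: closure_offZ.
apply: (@closure_off_inv _ _ _ _ _ _ (r^-1)).
- by rewrite invr_gt0 (imag_norm_gt0 b_upper).
- move=> y; have := resolvent_den_ge S_sa b_upper y.
  by rewrite imagN imag_star opprK.
rewrite starB -incl_star S_sa opprB; apply: closure_offB => //.
exact: closure_off_incl.
Qed.

Let r_gt0 : 0 < r. Proof. exact: imag_norm_gt0. Qed.
Let Q_norm : vnorm Q <= r. Proof. exact: vnorm_resolvent_le. Qed.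
Let Rn_norm : vnorm Rn <= r.
Proof. exact: (vnorm_resolvent_le normalized_sum_selfadjoint). Qed.

Let h_norm : vnorm h <= r. Proof. exact: vnorm_cauchy_le. Qed.
Let g_norm : vnorm g <= r.
Proof. exact: (vnorm_cauchy_le normalized_sum_selfadjoint). Qed.

Let e_gt0 : 0 < e. Proof. by rewrite invr_gt0 sqrtr_gt0 ltr0n. Qed.
Let sx : star x = x. Proof. exact: X_selfadjoint. Qed.
Let gx : generated_algebra x x. Proof. exact: gen_self. Qed.

Let exx : E (x * x) = eta 1.
Proof. by rewrite -(covariance_ident i) /covariance incl1 mulr1. Qed.

Let eta_le c : vnorm (eta c) <= a2 * vnorm c. Proof. exact: vnorm_covariance_le. Qed.

(** Inserting [resolvent_l] into this expansion leaves the full resolvent between [Q * x] and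
    [x * Q]. *)
Let resolvent_r : Rn = Q + e%:C *: (Q * x * Rn).
Proof.
have uT := resolvent_unit normalized_sum_selfadjoint b_upper.
have uS := resolvent_unit S_sa b_upper.
rewrite -[e%:C *: _]addr0 -{1}(mulKr uS Rn) -/Q.
have -> : inc b - S = (inc b - Sn) + e%:C *: x by rewrite /S opprB addrA addrAC.
rewrite mulrDl mulrDr mulrV // mulr1 addr0 -scalerAl -scalerAr mulrA.
by [].
Qed.

Let resolvent_l : Rn = Q + e%:C *: (Rn * x * Q).
Proof.
have uT := resolvent_unit normalized_sum_selfadjoint b_upper.
have uS := resolvent_unit S_sa b_upper.
rewrite -{1}(mulrK uS Rn) -/Q.
have -> : inc b - S = (inc b - Sn) + e%:C *: x by rewrite /S opprB addrA addrAC.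
by rewrite mulrDr mulVr // mulrDl mul1r -scalerAr -scalerAl.
Qed.

Let QxxQ_norm : vnorm (E (Q * (x * x) * star Q)) <= r ^+ 2 * a2.
Proof.
rewrite (cexp_free_yaz X_free (genM gx gx) Q_off Qs_off) exx.
apply: le_trans (vnorm_cexp_le _) _; apply: le_trans (vnormM _ _) _.
rewrite vnorm_star; apply: (@le_trans _ _ (r * a2 * r)); last by lra.
apply: ler_pM; rewrite ?vnorm_ge0 //; apply: le_trans (vnormM _ _) _.
apply: ler_pM; rewrite ?vnorm_ge0 //; apply: le_trans (incl_vnorm_le _ _) _.
by apply: le_trans (eta_le 1) _; rewrite vnorm1 mulr1.
Qed.

Let QsxxQ_norm : vnorm (E (star Q * (x * x) * Q)) <= r ^+ 2 * a2.
Proof.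
rewrite (cexp_free_yaz X_free (genM gx gx) Qs_off Q_off) exx.
apply: le_trans (vnorm_cexp_le _) _; apply: le_trans (vnormM _ _) _.
apply: (@le_trans _ _ (r * a2 * r)); last by lra.
apply: ler_pM; rewrite ?vnorm_ge0 //; apply: le_trans (vnormM _ _) _.
apply: ler_pM; rewrite ?vnorm_ge0 ?vnorm_star //; apply: le_trans (incl_vnorm_le _ _) _.
by apply: le_trans (eta_le 1) _; rewrite vnorm1 mulr1.
Qed.

Let a2_ge0 : 0 <= a2. Proof. exact: alpha2_ge0. Qed.
Let a4_ge0 : 0 <= a4. Proof. exact: alpha4_ge0. Qed.

(** Cauchy-Schwarz separates [Q * x], whose square is controlled by freeness, from the resolvent of
    the full sum, controlled by its norm. *)
Let g_sub_h : vnorm (g - h) <= e * (r ^+ 2 * Num.sqrt a2).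
Proof.
have -> : g - h = e%:C *: E (Q * x * Rn).
  by rewrite /g /cauchy -/Rn {1}resolvent_r cexpD cexpZ addrC addKr.
rewrite vnormZ ger0_norm ?ler_pM2l // ?(ltW e_gt0) //.
have -> : Q * x * Rn = star (x * star Q) * Rn by rewrite starM starK sx.
have -> : r ^+ 2 * Num.sqrt a2 = (r * Num.sqrt a2) * r by ring.
apply: cexp_cs; rewrite ?mulr_ge0 ?sqrtr_ge0 ?(ltW r_gt0) //.
  by rewrite exprMn sqr_sqrtr // starM starK sx !mulrA -(mulrA Q).
apply: le_trans (vnorm_cexp_starM_le _) _.
by rewrite lerXn2r ?nnegrE ?vnorm_ge0 ?(ltW r_gt0).
Qed.

Let fourth_norm : vnorm (E (x * Q * (x * x) * star Q * x)) <= r ^+ 2 * (a4 + 2 * a2 ^+ 2).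
Proof.
(* The first term is a fourth moment and gives [a4]. In the second, each half of the covariance of
   [Q] and [star Q] is at most [r ^+ 2 * a2], and [eta] costs another [a2], hence [2 * a2 ^+ 2]. *)
rewrite (cexp_free_xyazx X_free gx (genM gx gx) Q_off Qs_off) exx cexp_star -/h.
rewrite -[E (x * inc (_ - _) * x)]/(covariance x _) covariance_ident !mulrA fourth_ident.
apply: le_trans (vnormD _ _) _; rewrite mulrDr; apply: lerD.
  apply: le_trans (vnorm_fourth_le _ _) _; rewrite mulrC ler_wpM2r //.
  by rewrite lerXn2r ?nnegrE ?vnorm_ge0 ?(ltW r_gt0).
apply: le_trans (eta_le _) _.
have -> : r ^+ 2 * (2 * a2 * a2) = a2 * (r ^+ 2 * a2 + r ^+ 2 * a2) by ring.
rewrite ler_wpM2l //; apply: le_trans (vnormB _ _) _; apply: lerD.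
  by rewrite -exx -(cexp_free_yaz X_free (genM gx gx) Q_off Qs_off).
apply: le_trans (vnormM _ _) _; apply: (@le_trans _ _ (r * a2 * r)); last by lra.
apply: ler_pM; rewrite ?vnorm_ge0 ?vnorm_star //; apply: le_trans (vnormM _ _) _.
apply: ler_pM; rewrite ?vnorm_ge0 //.
by apply: le_trans (eta_le 1) _; rewrite vnorm1 mulr1.
Qed.

Let remainder_norm : vnorm (E (x * Q * x * Rn * x * Q)) <=
  r ^+ 3 * (Num.sqrt a2 * Num.sqrt (a4 + 2 * a2 ^+ 2)).
Proof.
have s0 : 0 <= a4 + 2 * a2 ^+ 2 by rewrite addr_ge0 // mulr_ge0 ?sqr_ge0.
(* The cut for Cauchy-Schwarz puts the full resolvent at the front of the second factor, where it
   can be traded for its norm. *)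
have -> : x * Q * x * Rn * x * Q = star (x * star Q * x) * (Rn * (x * Q)).
  by rewrite !starM starK sx !mulrA.
have -> : r ^+ 3 * (Num.sqrt a2 * Num.sqrt (a4 + 2 * a2 ^+ 2)) =
  (r * Num.sqrt (a4 + 2 * a2 ^+ 2)) * (r ^+ 2 * Num.sqrt a2) by ring.
apply: cexp_cs; rewrite ?mulr_ge0 ?sqrtr_ge0 ?sqr_ge0 ?(ltW r_gt0) //.
  by rewrite exprMn sqr_sqrtr // !starM starK sx; have := fourth_norm; rewrite !mulrA.
apply: le_trans (vnorm_cexp_mul_le _ _) _; rewrite exprMn sqr_sqrtr //.
have -> : (r ^+ 2) ^+ 2 * a2 = r ^+ 2 * (r ^+ 2 * a2) by ring.
apply: ler_pM; rewrite ?sqr_ge0 ?vnorm_ge0 //.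
  by rewrite lerXn2r ?nnegrE ?vnorm_ge0 ?(ltW r_gt0).
by rewrite starM sx !mulrA -(mulrA (star Q)).
Qed.

Lemma cexp_term_le : vnorm (E (x * Rn) - e%:C *: (eta g * g)) <=
  e ^+ 2 * (r ^+ 3 * Num.sqrt a2 * (2 * a2 + Num.sqrt (a4 + 2 * a2 ^+ 2))).
Proof.
have Exp : E (x * Rn) = e%:C *: (eta h * h) + (e ^+ 2)%:C *: E (x * Q * x * Rn * x * Q).
  rewrite {1}resolvent_r {1}resolvent_l !(mulrDr, scalerDr) -!(scalerAr, scalerAl).
  rewrite !cexpD !cexpZ (cexp_gen_closure X_free gx Q_off) X_centred mul0r add0r.
  rewrite !mulrA (cexp_free_xyxz X_free gx (X_centred i) Q_off Q_off).
  by rewrite -[E (x * inc _ * x)]/(covariance x h) covariance_ident scalerA -rmorphM -expr2.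
rewrite Exp addrAC -scalerBr; apply: le_trans (vnormD _ _) _.
rewrite !vnormZ !ger0_norm ?sqr_ge0 ?(ltW e_gt0) //.
(* Replacing [h], which depends on [i], by the common [g] costs one more factor [e], so this error
   has the same order as the remainder. *)
have diff : vnorm (eta h * h - eta g * g) <= 2 * a2 * r * (e * (r ^+ 2 * Num.sqrt a2)).
  have -> : eta h * h - eta g * g = eta (h - g) * h + eta g * (h - g).
    have -> : eta (h - g) = eta h - eta g.
      by rewrite /covariance inclB mulrBr mulrBl cexpB.
    by rewrite mulrBl mulrBr addrA subrK.
  have dh : vnorm (h - g) <= e * (r ^+ 2 * Num.sqrt a2) by rewrite vnorm_distC.
  set t := e * _ in dh *.
  have -> : 2 * a2 * r * t = a2 * t * r + a2 * r * t by ring.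
  apply: le_trans (vnormD _ _) _; apply: lerD; apply: le_trans (vnormM _ _) _.
    apply: ler_pM; rewrite ?vnorm_ge0 //.
    by apply: le_trans (eta_le _) _; rewrite ler_wpM2l.
  apply: ler_pM; rewrite ?vnorm_ge0 //.
  by apply: le_trans (eta_le _) _; rewrite ler_wpM2l.
have h1 := ler_wpM2l (ltW e_gt0) diff.
have h2 := ler_wpM2l (sqr_ge0 e) remainder_norm.
apply: le_trans (lerD h1 h2) _; rewrite le_eqVlt; apply/orP; left; apply/eqP; ring.
Qed.

End Term.

Lemma master_equation_le :
  vnorm (b * g - 1 - eta g * g) <=
  e * (r ^+ 3 * Num.sqrt a2 * (2 * a2 + Num.sqrt (a4 + 2 * a2 ^+ 2))).
Proof.
have e_gt0 : 0 < e by rewrite invr_gt0 sqrtr_gt0 ltr0n.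
(* Hence [eta g * g] is shared equally among the [n] summands, and [n] errors of order [e ^+ 2],
   multiplied by [e], add up to order [e]. *)
have ne : e * (n%:R * e) = 1.
  rewrite /e mulrCA -invfM -expr2 sqr_sqrtr ?ler0n // mulfV // pnatr_eq0.
  by rewrite -lt0n.
have uT := resolvent_unit normalized_sum_selfadjoint b_upper.
have -> : b * g - 1 - eta g * g =
    e%:C *: (\sum_(i < n) (E (X i * Rn) - e%:C *: (eta g * g))).
  rewrite sumrB scalerBr sumr_const card_ord -scaler_nat !scalerA.
  rewrite -(rmorph_nat (real_complex R)) -!rmorphM /= -mulrA ne scale1r.
  congr (_ - _); rewrite -cexp_mull -{1}(subrK Sn (inc b)) mulrDl mulrV // cexpD cexp1.
  rewrite addrC addKr /normalized_sum -scalerAl cexpZ; congr (_ *: _).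
  by rewrite mulr_suml raddf_sum.
rewrite vnormZ ger0_norm ?(ltW e_gt0) // ler_pM2l //.
apply: le_trans (vnorm_sum _) _.
set K := r ^+ 3 * _ * _.
apply: (@le_trans _ _ (\sum_(i < n) e ^+ 2 * K)).
  by apply: ler_sum => i _; exact: cexp_term_le.
rewrite sumr_const card_ord -mulr_natl mulrA expr2 mulrA (mulrC _ e) ne mul1r.
exact: lexx.
Qed.

End MasterEquation.

(** * The equation for the semicircular element *)

(** Half of the decay is spent on the linear factor: with [t = Num.sqrt q], [n.+1%:R * t ^+ n] is at
    most the sum of the powers of [t], and one factor [t ^+ n] remains. *)
Lemma arith_geometric_small (R : realType) (M q e : R) : 0 <= q -> q < 1 -> 0 < e -> 0 <= M ->
  exists n : nat, M * (n.+1%:R * q ^+ n) <= e.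
Proof.
move=> q0 q1 e0 M0; pose t := Num.sqrt q.
have t0 : 0 <= t by rewrite sqrtr_ge0.
have t1 : t < 1 by rewrite -[X in _ < X]sqrtr1 ltr_sqrt.
have t1' : 0 < 1 - t by rewrite subr_gt0.
have qE : q = t ^+ 2 by rewrite sqr_sqrtr.
have bound n : n.+1%:R * t ^+ n <= (1 - t)^-1.
  apply: (@le_trans _ _ (\sum_(k < n.+1) t ^+ k)).
    have -> : n.+1%:R * t ^+ n = \sum_(k < n.+1) t ^+ n.
      by rewrite sumr_const card_ord mulr_natl.
    apply: ler_sum => k _; have kn : (k <= n)%N by rewrite -ltnS.
    by apply: ler_wiXn2l => //; exact: ltW.
  rewrite -[leRHS]mulr1 ler_pdivlMl //.
  have := subrX1 t n.+1 => h.
  have -> : (1 - t) * \sum_(k < n.+1) t ^+ k = 1 - t ^+ n.+1.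
    by move: h; set S := \sum_(_ < _) _ => h; lra.
  by rewrite gerBl exprn_ge0.
have [n hn] := geometric_small (M / (1 - t)) t0 t1 e0.
exists n; apply: le_trans (hn n (leqnn _)).
rewrite -mulrA ler_wpM2l // qE exprAC expr2 mulrA ler_wpM2r ?exprn_ge0 //.
Qed.

Section Semicircular.
Variables (R : realType) (B : vonNeumannAlgebra R) (A : ovProbSpace B).
Variables (eta : B -> B) (s : A).
Hypothesis eta_linear : linear eta.
Hypothesis s_semicircular : semicircular eta s.
Local Notation inc := (incl A).
Local Notation E := (cexp A).
Implicit Types b : nat -> B.

(* The monomial [b_i s b_(i+1) s ... s b_k]. *)
Definition monomial b i k : A := inc (b i) * \prod_(i.+1 <= j < k.+1) (s * inc (b j)).

Lemma monomial_id b i : monomial b i i = inc (b i).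
Proof. by rewrite /monomial big_geq // mulr1. Qed.

Lemma monomialS b i k : (i <= k)%N -> monomial b i k.+1 = monomial b i k * (s * inc (b k.+1)).
Proof. by move=> ik; rewrite /monomial big_nat_recr //= mulrA. Qed.

Lemma eq_monomial b c i k : (i <= k)%N -> (forall j, (i <= j <= k)%N -> b j = c j) ->
  monomial b i k = monomial c i k.
Proof.
move=> ik bc; rewrite /monomial bc ?leqnn ?ik //; congr (_ * _).
by apply: eq_big_nat => j /andP[ij jk]; rewrite bc // (ltnW ij).
Qed.

Lemma monomial_moment b i m :
  E (monomial b i (i + m.+1)) = b i * moment s m.+1 (fun l => b (i + l)%N) * b (i + m.+1)%N.
Proof.
rewrite /monomial cexp_mull -mulrA; congr (_ * _); rewrite /moment -cexp_mulr; congr (E _).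
elim: m => [|m IH].
  by rewrite addn1 big_nat1 big_geq // mulr1.
rewrite addnS big_nat_recr /=; last by rewrite ltnS leq_addr.
rewrite {}IH (big_nat_recr m.+1) //= !mulrA.
by [].
Qed.

Lemma cexp_s_monomial b k : (1 <= k)%N ->
  E (s * monomial b 1 k) = moment s k b * b k.
Proof.
(* With coefficient 1 at index 0, the product [s * monomial b 1 k] becomes a monomial starting at
   0. *)
case: k => // k _; have := monomial_moment (fun l => if l == 0%N then 1 else b l) 0 k.
rewrite /monomial /= incl1 !mul1r add0n big_ltn // /= !mulrA => h.
have -> : \prod_(2 <= j < k.+2) (s * inc (b j)) =
   \prod_(2 <= j < k.+2) (s * inc (if j == 0%N then 1 else b j)).
  by apply: eq_big_nat => j /andP[]; case: j.
rewrite h; congr (_ * _); rewrite /moment; congr (E (_ * _)).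
by apply: eq_big_nat => j /andP[]; case: j.
Qed.

(** The leading [s] is paired with the factor [s] between [b j.-1] and [b j]. In this form all cases
    of the moment recursion have the same shape. *)
Lemma schwinger_dyson_monomial b k : (1 <= k)%N ->
  E (s * monomial b 1 k) =
  \sum_(2 <= j < k.+1) eta (E (monomial b 1 j.-1)) * E (monomial b j k).
Proof.
move=> k1; rewrite (cexp_s_monomial _ k1); case: s_semicircular => _ m1 rec.
have [k2|k2] := leqP 2 k; last first.
  have -> : k = 1%N by apply/eqP; rewrite eqn_leq k1 -ltnS k2.
  by rewrite m1 mul0r big_geq.
rewrite (rec k b k2) /= [RHS]big_ltn ?ltnS // monomial_id cexp_incl mulrDl.
have tE j : (2 <= j < k.+1)%N ->
   (if j == k then 1 else b j * moment s (k - j) (fun l => b (j + l)%N)) * b k =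
   E (monomial b j k).
  move=> /andP[_]; rewrite ltnS leq_eqVlt => /orP[/eqP ->|jk].
    by rewrite eqxx mul1r monomial_id cexp_incl.
  have [m ->] : exists m, k = (j + m.+1)%N by exists (k - j).-1; lia.
  rewrite monomial_moment addKn; case: eqP => // h; lia.
congr (_ + _); first by rewrite -mulrA tE // k2 ltnS.
rewrite mulr_suml; apply: eq_big_nat => j /andP[j3 jk].
rewrite -mulrA tE ?jk ?(ltnW j3) //; congr (eta _ * _).
have [m ->] : exists m, j = m.+3 by exists (j - 3)%N; lia.
by rewrite /= -[m.+2]/(1 + m.+1)%N monomial_moment; congr (_ * _ * _).
Qed.

(** The first sum pairs the leading [s] with an [s] of the monomial, the second with the [s] of a
    factor [q]. A general monomial is carried along because expanding a factor [q] changes it. *)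
Lemma schwinger_dyson_mul (beta : B) (c : R[i]) m b k : (1 <= k)%N ->
  let q := inc beta + c *: s in
  E (s * monomial b 1 k * q ^+ m) =
  \sum_(2 <= j < k.+1) eta (E (monomial b 1 j.-1)) * E (monomial b j k * q ^+ m)
  + c *: \sum_(l < m) eta (E (monomial b 1 k * q ^+ l)) * E (q ^+ (m.-1 - l)).
Proof.
move=> + q; elim: m b k => [|m IH] b k k1.
  rewrite big_ord0 scaler0 addr0 expr0 mulr1 schwinger_dyson_monomial //.
  by apply: eq_bigr => j _; rewrite mulr1.
(* For the expansion of one factor [q]: [b1] absorbs [beta] into the last coefficient, [b2] appends
   an [s] followed by the coefficient 1. *)
pose b1 j := if j == k then b j * beta else b j.
pose b2 j := if j == k.+1 then 1 else b j.
have b1E j : (j <= k)%N -> monomial b1 j k = monomial b j k * inc beta.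
  rewrite leq_eqVlt => /orP[/eqP ->|jk]; first by rewrite !monomial_id /b1 eqxx inclM.
  case: k jk {k1} @b1 @b2 => // k jk b1 b2.
  rewrite !monomialS // {2}/b1 eqxx inclM !mulrA; congr (_ * _ * _ * _).
  by apply: eq_monomial => // l /andP[_ lk]; rewrite /b1; case: eqP => // h; lia.
have b1E' j : (1 <= j < k)%N -> monomial b1 1 j = monomial b 1 j.
  move=> /andP[j1 jk]; apply: eq_monomial => // l /andP[_ lj]; rewrite /b1.
  by case: eqP => // h; lia.
have b2E' j i : (i <= j <= k)%N -> monomial b2 i j = monomial b i j.
  move=> /andP[ij jk]; apply: eq_monomial => // l /andP[_ lj]; rewrite /b2.
  by case: eqP => // h; lia.
have b2E j : (j <= k)%N -> monomial b2 j k.+1 = monomial b j k * s.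
  by move=> jk; rewrite monomialS // b2E' ?jk ?leqnn // /b2 eqxx incl1 mulr1.
have split_q (w : A) l : w * inc beta * q ^+ l + c *: (w * s * q ^+ l) = w * q ^+ l.+1.
  by rewrite exprS mulrA /q mulrDr mulrDl -!scalerAr -scalerAl.
have -> : s * monomial b 1 k * q ^+ m.+1 =
   s * monomial b1 1 k * q ^+ m + c *: (s * monomial b2 1 k.+1 * q ^+ m).
  by rewrite b1E // b2E // !mulrA -split_q.
(* The pairing with the appended [s], of index [k.+1], becomes the term [l = 0] of the second
   sum. *)
rewrite cexpD cexpZ !IH // (big_nat_recr k.+1 2) //= monomial_id {4}/b2 eqxx incl1 mul1r.
rewrite b2E' ?k1 ?leqnn //.
have comb (P1 P2 Q1 Q2 h : B) : P1 + c *: Q1 + c *: (P2 + h + c *: Q2) =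
    P1 + c *: P2 + c *: (h + (Q1 + c *: Q2)).
  by rewrite !scalerDr -(addrA (c *: P2)) addrACA [in LHS](addrCA (c *: Q1)).
rewrite comb big_ord_recl /= expr0 mulr1 subn0; congr (_ + c *: (_ + _)).
  rewrite scaler_sumr -big_split /=; apply: eq_big_nat => j /andP[j2 jk].
  rewrite (b1E' j.-1) ?(b2E' j.-1 1%N) ?(b1E j) ?(b2E j) ?mulrA //; try lia.
  by rewrite scalerAr -mulrDr -cexpZ -cexpD split_q.
rewrite scaler_sumr -big_split /=; apply: eq_bigr => l _.
rewrite b1E ?b2E // scalerAl -mulrDl addrC -eta_linear -cexpZ -cexpD addrC split_q.
by congr (_ * E (q ^+ _)); rewrite /bump /=; lia.
Qed.

(** * From powers to the resolvent of the semicircular element *)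

Section Resolvent.
Hypothesis eta_bounded : exists C : R, forall c, vnorm (eta c) <= C * vnorm c.
Variable b : B.
Hypothesis b_upper : upper_half b.
Let Q := (inc b - s)^-1.

Lemma schwinger_dyson_power (beta : B) (c : R[i]) m : let q := inc beta + c *: s in
  E (s * q ^+ m) = c *: \sum_(l < m) eta (E (q ^+ l)) * E (q ^+ (m.-1 - l)).
Proof.
move=> q; have := @schwinger_dyson_mul beta c m (fun=> 1) 1 isT.
rewrite /= monomial_id incl1 mulr1 big_geq // add0r => ->.
by congr (_ *: _); apply: eq_bigr => l _; rewrite mul1r.
Qed.

Lemma schwinger_dyson_resolvent : E (s * Q) = eta (E Q) * E Q.
Proof.
have [sa _ _] := s_semicircular.
have r0 := imag_norm_gt0 b_upper.
have Q_ge := resolvent_den_ge sa b_upper.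
have rV0 : 0 < (vnorm (imag b)^-1)^-1 by rewrite invr_gt0.
have [c [rho [/andP[rho0 rho1] hq hinv]]] := inv_approx rV0 Q_ge.
have [C hC] := eta_bounded; rewrite -/Q in hinv.
set q := 1 + _ in hq hinv; set c' := - (c%:C * 'i%C) in hinv.
have qE : q = inc (1 + (c%:C * 'i%C) *: b) + c' *: s.
  by rewrite inclD incl1 inclZ -addrA /c' scaleNr -scalerBr.
pose P n := c' *: \sum_(k < n) q ^+ k.
have PS n : P n.+1 = P n + c' *: q ^+ n by rewrite /P big_ord_recr /= scalerDr.
have etaZ (z : R[i]) u : eta (z *: u) = z *: eta u.
  have eta0 : eta 0 = 0.
    have := eta_linear 1 0 0; rewrite !scale1r addr0 => /eqP.
    by rewrite -subr_eq subrr => /eqP.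
  by rewrite -[z *: u]addr0 eta_linear eta0 addr0.
have etaD u v : eta (u + v) = eta u + eta v.
  by have := eta_linear 1 u v; rewrite !scale1r.
(* Summing the identity for powers gives a Cauchy product whose second factors are partial sums
   [P]. *)
have EsP n : E (s * P n) = \sum_(l < n) (c' *: eta (E (q ^+ l))) * E (P (n.-1 - l)%N).
  elim: n => [|n IH]; first by rewrite /P !big_ord0 scaler0 mulr0 raddf0.
  rewrite PS mulrDr cexpD IH -scalerAr cexpZ.
  have -> : E (s * q ^+ n) = c' *: \sum_(l < n) eta (E (q ^+ l)) * E (q ^+ (n.-1 - l)).
    by rewrite qE; exact: schwinger_dyson_power.
  rewrite big_ord_recr /= subnn {3}/P big_ord0 scaler0 raddf0 mulr0 addr0.
  rewrite !scaler_sumr -big_split /=; apply: eq_bigr => l _; have ln := ltn_ord l.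
  have -> : (n - l = (n.-1 - l).+1)%N by lia.
  by rewrite PS cexpD mulrDr (cexpZ _ (q ^+ _)) -!scalerAl -scalerAr.
have C0 : 0 <= C by have := hC 1; rewrite vnorm1 mulr1; apply: le_trans (vnorm_ge0 _).
have QP n : Q = P n + q ^+ n * Q by exact: hinv.
have EQP n : E (P n) = E Q - E (q ^+ n * Q) by rewrite [in E Q](QP n) cexpD addrK.
have qn n (w : A) : vnorm (q ^+ n * w) <= rho ^+ n * vnorm w.
  apply: le_trans (vnormM _ _) _; rewrite ler_wpM2r ?vnorm_ge0 //.
  by apply: le_trans (vnormX _ _) _; rewrite lerXn2r ?nnegrE ?vnorm_ge0.
(* Replacing the partial sums by [Q] leaves three errors, each with at least [n] factors [q] in
   total. *)
have decomp n : E (s * Q) - eta (E Q) * E Q = E (s * (q ^+ n.+1 * Q))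
    - eta (E (q ^+ n.+1 * Q)) * E Q
    - \sum_(l < n.+1) (c' *: eta (E (q ^+ l))) * E (q ^+ (n - l) * Q).
  rewrite {1}(QP n.+1) mulrDr cexpD EsP /=.
  have -> : \sum_(l < n.+1) c' *: eta (E (q ^+ l)) * E (P (n - l)%N) =
      eta (E (P n.+1)) * E Q - \sum_(l < n.+1) (c' *: eta (E (q ^+ l))) * E (q ^+ (n - l) * Q).
    have -> : eta (E (P n.+1)) = \sum_(l < n.+1) c' *: eta (E (q ^+ l)).
      rewrite /P cexpZ etaZ -scaler_sumr raddf_sum /=; congr (_ *: _).
      elim/big_rec2: _ => [|l u v _ <-]; last by rewrite etaD.
      by rewrite -(scale0r 0) etaZ !scale0r.
    rewrite mulr_suml -sumrB; apply: eq_bigr => l _.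
    by rewrite EQP mulrBr.
  rewrite EQP; have -> (u v : B) : eta (u - v) = eta u - eta v.
    by rewrite etaD -scaleN1r etaZ scaleN1r.
  rewrite mulrBl; apply/eqP; rewrite subr_eq addrC -!addrA; apply/eqP.
  by congr (_ + _); rewrite [LHS]addrC [RHS]addrA.
(* One summand per error; the last error has [n.+1] terms of size [rho ^+ n], which is why [n.+1%:R]
   appears in [err]. *)
pose K := vnorm s * vnorm Q + C * vnorm Q * vnorm Q + complex.Re `|c'| * C * vnorm Q.
have c'0 : 0 <= complex.Re `|c'| by rewrite normc_def sqrtr_ge0.
have K0 : 0 <= K by rewrite !addr_ge0 // !mulr_ge0 ?vnorm_ge0.
have err n : vnorm (E (s * Q) - eta (E Q) * E Q) <= K * (n.+1%:R * rho ^+ n).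
  have rn : rho ^+ n.+1 <= n.+1%:R * rho ^+ n.
    rewrite exprS; apply: ler_wpM2r; first exact: exprn_ge0.
    by apply: le_trans (ltW rho1) _; rewrite ler1n.
  rewrite (decomp n); apply: le_trans (vnormB _ _) _; rewrite /K mulrDl; apply: lerD.
    apply: le_trans (vnormB _ _) _; rewrite mulrDl; apply: lerD.
      apply: le_trans (vnorm_cexp_le _) _; apply: le_trans (vnormM _ _) _.
      rewrite -mulrA ler_wpM2l ?vnorm_ge0 //; apply: le_trans (qn _ _) _.
      by rewrite mulrC ler_wpM2l ?vnorm_ge0.
    apply: le_trans (vnormM _ _) _; rewrite [leRHS]mulrAC.
    apply: ler_pM (vnorm_cexp_le _); rewrite ?vnorm_ge0 //.
    apply: le_trans (hC _) _; rewrite -mulrA ler_wpM2l //.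
    apply: le_trans (vnorm_cexp_le _) _; apply: le_trans (qn _ _) _.
    by rewrite mulrC ler_wpM2l ?vnorm_ge0.
  apply: le_trans (vnorm_sum _) _.
  apply: (@le_trans _ _ (\sum_(l < n.+1) complex.Re `|c'| * C * vnorm Q * rho ^+ n)).
    apply: ler_sum => l _; apply: le_trans (vnormM _ _) _.
    have ln : (l <= n)%N by rewrite -ltnS.
    have -> : rho ^+ n = rho ^+ l * rho ^+ (n - l) by rewrite -exprD subnKC.
    have -> : complex.Re `|c'| * C * vnorm Q * (rho ^+ l * rho ^+ (n - l)) =
       (complex.Re `|c'| * (C * rho ^+ l)) * (rho ^+ (n - l) * vnorm Q) by ring.
    apply: ler_pM; rewrite ?vnorm_ge0 //.
      apply: le_trans (vnormZ_le _ _) _; rewrite ler_wpM2l //.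
      apply: le_trans (hC _) _; rewrite ler_wpM2l //.
      apply: le_trans (vnorm_cexp_le _) _; rewrite -[q ^+ l]mulr1.
      by apply: le_trans (qn _ _) _; rewrite vnorm1 mulr1.
    exact: le_trans (vnorm_cexp_le _) (qn _ _).
  by rewrite sumr_const card_ord -[leLHS]mulr_natl mulrCA.
apply: subr0_eq; apply: vnorm_eq0; apply/eqP; rewrite eq_le vnorm_ge0 andbT.
apply/ler_addgt0Pr => e e0; rewrite add0r.
have [n hn] := arith_geometric_small rho0 rho1 e0 K0.
exact: le_trans (err n) hn.
Qed.

Lemma semicircular_cauchy : b * cauchy s b = 1 + eta (cauchy s b) * cauchy s b.
Proof.
have [sa _ _] := s_semicircular.
rewrite /cauchy -schwinger_dyson_resolvent -cexp_mull -{1}(subrK s (inc b)) mulrDl.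
by rewrite mulrV ?cexpD ?cexp1 // (resolvent_unit sa).
Qed.

End Resolvent.

End Semicircular.

(** * The main estimate *)

Section Distance.
Variables (R : realType) (B : vonNeumannAlgebra R).

Lemma vnorm_cauchy_diff_le_imag (A A' : ovProbSpace B) (S : A) (s : A') (b : B) :
  selfadjoint S -> selfadjoint s -> upper_half b ->
  vnorm (cauchy S b - cauchy s b) <= vnorm (imag b)^-1.
Proof.
move=> sS ss bu; set r := vnorm _.
have := lerD (cauchy_disk sS bu) (cauchy_disk ss bu); rewrite -/r -splitr.
apply: le_trans; apply: le_trans (vnormB _ _).
by rewrite opprD addrACA subrr addr0.
Qed.

Lemma upper_half_norm_ge1 (b : B) : upper_half b -> 1 <= vnorm b * vnorm (imag b)^-1.
Proof.
move=> [_ ub]; apply: le_trans (vnorm_mulV_ge1 ub) _.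
by rewrite ler_wpM2r ?vnorm_ge0 ?vnorm_imag.
Qed.

(** From [f * g = 1 + t] follows [g^-1 = (1 + t)^-1 * f], so the difference is
    [- ((1 + t)^-1 * t * f)]; as [c <= 2^-1], the inverse of [1 + t] has norm at most 2. *)
Lemma perturbed_inverse (g t f : B) (c : R) : g \is a GRing.unit -> c <= 2^-1 ->
  vnorm t <= c -> f * g = 1 + t -> vnorm (g^-1 - f) <= 2 * c * vnorm f.
Proof.
move=> ug c2 tc fg.
have t2 : vnorm (- t) <= 2^-1 by rewrite vnormN; exact: le_trans tc c2.
have uV : 1 + t \is a GRing.unit.
  by rewrite -[t]opprK; apply: neumann_unit t2; rewrite invf_lt1 ?ltr1n.
have hV : vnorm (1 + t)^-1 <= 2.
  rewrite -[2]invrK; apply: vnorm_inv_le => // x.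
  have := hnormD ((1 + t) @< x) ((- t) @< x); rewrite -actDl addrK vn_act1.
  have := hnorm_act (- t) x; have := ler_wpM2r (hnorm_ge0 x) t2; lra.
have -> : g^-1 - f = - ((1 + t)^-1 * t * f).
  have -> : g^-1 = (1 + t)^-1 * f by rewrite -[f](mulrK ug) fg !mulrA mulVr // mul1r.
  have fE : f = (1 + t)^-1 * (f + t * f).
    by rewrite -{2}[f]mul1r -mulrDl mulrA mulVr // mul1r.
  by rewrite {2}fE -mulrBr opprD addrA subrr add0r mulrN mulrA.
rewrite vnormN; apply: le_trans (vnormM _ _) _; rewrite ler_wpM2r ?vnorm_ge0 //.
by apply: le_trans (vnormM _ _) _; rewrite ler_pM ?vnorm_ge0.
Qed.

End Distance.
Theorem theorem1 (R : realType) (B : vonNeumannAlgebra R) (A : ovProbSpace B)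
    (X : nat -> A) :
  (forall i, selfadjoint (X i)) ->
  free_family X ->
  identically_distributed X ->
  (forall i, cexp A (X i) = 0) ->
  forall (A' : ovProbSpace B) (s : A'), semicircular (covariance (X 0%N)) s ->
  forall (b : B) (n : nat), upper_half b -> (1 <= n)%N ->
  let Sn := normalized_sum X n in
  let a2 := alpha2 (X 0%N) in
  let a4 := alpha4 (X 0%N) in
  let r := vnorm (imag b)^-1 in
  let cn := (Num.sqrt n%:R)^-1 * r ^+ 3 * Num.sqrt a2
              * (2 * a2 + Num.sqrt (a4 + 2 * a2 ^+ 2))
            + n%:R^-1 * r ^+ 4 * a2 ^+ 2 in
  vnorm (cauchy Sn b - cauchy s b) <= 4 * cn * (vnorm b + a2 * r) * r ^+ 2.
Proof.
move=> sX fX iX cX A' s ss b n bu n1.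
pose Sn := normalized_sum X n; pose a2 := alpha2 (X 0%N); pose a4 := alpha4 (X 0%N).
pose r := vnorm (imag b)^-1.
pose cn := (Num.sqrt n%:R)^-1 * r ^+ 3 * Num.sqrt a2 * (2 * a2 + Num.sqrt (a4 + 2 * a2 ^+ 2))
  + n%:R^-1 * r ^+ 4 * a2 ^+ 2.
rewrite -[X in is_true X]/(vnorm (cauchy Sn b - cauchy s b) <=
  4 * cn * (vnorm b + a2 * r) * r ^+ 2).
have [sas _ _] := ss; have sSn : selfadjoint Sn by exact: normalized_sum_selfadjoint.
set g := cauchy Sn b; set h := cauchy s b; pose eta := covariance (X 0%N).
have eta_lin : linear eta by exact: covariance_linear.
have r0 : 0 < r := imag_norm_gt0 bu.
have a20 : 0 <= a2 := alpha2_ge0 _.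
pose M := vnorm b + a2 * r.
(* This turns smallness of the claimed bound into smallness of [cn]. *)
have Mr : 1 <= M * r.
  rewrite mulrDl; apply: le_trans (upper_half_norm_ge1 bu) _.
  by rewrite lerDl !mulr_ge0 // ltW.
have M0 : 0 < M by rewrite -(pmulr_lgt0 _ r0); exact: lt_le_trans Mr.
pose t := b * g - 1 - eta g * g.
have tcn : vnorm t <= cn.
  apply: le_trans (master_equation_le sX fX iX cX bu n1) _.
  rewrite -/r -/a2 -/a4 /cn -!mulrA lerDl.
  by rewrite !mulr_ge0 ?sqr_ge0 ?exprn_ge0 ?invr_ge0 // ltW.
have cn0 : 0 <= cn := le_trans (vnorm_ge0 _) tcn.
(* In the second case [4 * cn * M * r < 1], which is what keeps [l] within [k] of [b]. *)
have [big|small] := leP r (4 * cn * M * r ^+ 2).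
  exact: le_trans (vnorm_cauchy_diff_le_imag sSn sas bu) big.
have small' : 4 * cn * M * r < 1 by rewrite -(ltr_pM2r r0) mul1r; lra.
have cn4 : cn <= 2^-1.
  have : cn <= cn * (M * r) by rewrite ler_peMr.
  lra.
have ug : g \is a GRing.unit := cauchy_unit sSn bu.
have uh : h \is a GRing.unit := cauchy_unit sas bu.
have gn : vnorm g <= r := vnorm_cauchy_le sSn bu.
have fM : vnorm (b - eta g) <= M.
  apply: le_trans (vnormB _ _) _; rewrite lerD2l.
  by apply: le_trans (vnorm_covariance_le _ _) _; rewrite ler_wpM2l.
pose l := g^-1 + eta g.
have lb : vnorm (b - l) <= 2 * cn * M.
  rewrite vnorm_distC.
  have -> : l - b = g^-1 - (b - eta g) by rewrite /l opprB addrA.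
  apply: (le_trans (@perturbed_inverse _ _ g t (b - eta g) cn ug cn4 tcn _)).
    by rewrite mulrBl /t addrAC addrCA subrr addr0.
  by rewrite ler_wpM2l // mulr_ge0.
(* Half of the lower bound [r^-1] of [imag b]; the other half is spent on [b - l], so [k] also
   bounds [imag l] from below. With the 2 from [perturbed_inverse] this gives the constant 4. *)
pose k := (2 * r)^-1.
have k0 : 0 < k by rewrite invr_gt0 mulr_gt0.
have rk : r^-1 = k + k by rewrite /k; field; rewrite gt_eqF.
have bk : vnorm (b - l) <= k.
  apply: le_trans lb _; rewrite -[k]mul1r ler_pdivlMr ?mulr_gt0 //; lra.
have b_ge x : k * rdot x x <= rdot (vn_act (imag b) x) x.
  apply: le_trans (upper_half_ge bu x); rewrite -/r rk.
  by rewrite ler_wpM2r ?rdotxx_ge0 // lerDl ltW.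
have l_ge x : k * rdot x x <= rdot (vn_act (imag l) x) x.
  have -> : imag l = imag b - imag (b - l) by rewrite imagD imagN opprB addrC subrK.
  rewrite actBl rdotBl.
  have := upper_half_ge bu x; rewrite -/r rk => h1.
  have h2 := rdot_act_le1 (imag (b - l)) x.
  have h3 := ler_wpM2r (rdotxx_ge0 x) (le_trans (vnorm_imag (b - l)) bk).
  lra.
have hE : h^-1 = b - eta h.
  have := semicircular_cauchy eta_lin ss (ex_intro _ a2 (vnorm_covariance_le _)) bu.
  rewrite -/h => e; apply: (mulIr uh); rewrite mulVr // mulrBl e addrK.
  by [].
have gE : g^-1 = l - eta g by rewrite addrK.
have [d1 d10 g_le] := imag_cauchy_le sSn bu.
have [d2 d20 h_le] := imag_cauchy_le sas bu.
pose d := Num.min d1 d2.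
have d0 : 0 < d by rewrite lt_min d10.
have g_le' x : rdot (vn_act (imag g) x) x <= - d * rdot x x.
  apply: le_trans (g_le x) _; rewrite ler_wpM2r ?rdotxx_ge0 // lerN2.
  by rewrite ge_min lexx.
have h_le' x : rdot (vn_act (imag h) x) x <= - d * rdot x x.
  apply: le_trans (h_le x) _; rewrite ler_wpM2r ?rdotxx_ge0 // lerN2.
  by rewrite ge_min lexx orbT.
have main := vnorm_fixpoint_diff_le eta_lin (covariance_star (sX 0%N))
  (covariance_positive (sX 0%N)) (covariance_cs (sX 0%N)) k0 d0 r0 ug uh gE hE
  l_ge b_ge g_le' h_le' gn (vnorm_cauchy_le sas bu).
apply: le_trans main _; rewrite /k invrK.
have -> : 4 * cn * M * r ^+ 2 = 2 * r * (2 * cn * M) * r by ring.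
by rewrite !ler_wpM2r ?ler_wpM2l ?mulr_ge0 // ltW.
Qed.
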